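(* Let $G$ be a finite group, $P$ a $p$-subgroup of $G$, and $H$ a subgroup of $G$ containing $N_G(P)$. Let $b$ be a $p$-block of $G$ with defect group $P$, and let $e$ be the block of $H$ that is the Brauer correspondent of $b$. Suppose $F\colon\pm\operatorname{Irr}_0(G,P)\to\pm\operatorname{Irr}_0(H,P)$ is a signed bijection witnessing either (WIRC) or (WIRC* ) for the triple $(G,P,H)$. If $\chi\in\operatorname{Irr}_0(G,b)$ then $F(\chi)\in\pm\operatorname{Irr}_0(H,e)$ and $$\chi(1)_{p'}\equiv|G:H|_{p'}\,(F(\chi)(1))_{p'}\pmod p.$$ In particular, if $H=N_G(P)$ then for every $p$-block $b'$ of $G$ with defect group $P$, with Brauer correspondent $e'\in\operatorname{Bl}(H)$, and every integer $l$ not divisible by $p$ we have $M_{ml}(b')=M_l(e')$, where $m=|G:H|_{p'}$.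
   Context: $p$ is a prime. $\mathcal O$ is a complete discrete valuation ring of characteristic $0$ with fraction field $K$ and algebraically closed residue field of characteristic $p$, containing all needed roots of unity; characters are viewed as $K$-valued and extended linearly to group algebras. $\mathcal C(X)=\mathbb Z\operatorname{Irr}(X)$. $\operatorname{Bl}(X)$ is the set of $p$-blocks of $X$, i.e. primitive idempotents of $Z(\mathcal OX)$; $\operatorname{Irr}(X,b)=\{\chi\in\operatorname{Irr}(X)\mid\chi(b)\ne0\}$. For an integer $a$ coprime to $p$, $v_p(p^ma)=m$ and $(p^ma)_{p'}=a$. For a block $b$ with defect group $D$, $\operatorname{Irr}_0(X,b)$ is the set of $\chi\in\operatorname{Irr}(X,b)$ of height $0$, i.e. $v_p(\chi(1))=v_p(|X:D|)$; $M_l(b)$ is the number of $\chi\in\operatorname{Irr}_0(X,b)$ with $\chi(1)_{p'}\equiv\pm l\pmod p$. For a $p$-subgroup $P$ of $X$: $\operatorname{Irr}(X,P)$ is the union of $\operatorname{Irr}(X,b)$ over blocks $b$ of $X$ having some defect group contained in $P$; $\mathcal C(X,P)=\mathbb Z\operatorname{Irr}(X,P)$; $\operatorname{Proj}_P\colon\mathcal C(X)\to\mathcal C(X,P)$ is the linear projection killing the irreducible characters outside $\operatorname{Irr}(X,P)$; $\operatorname{Irr}_0(X,P)=\{\chi\in\operatorname{Irr}(X,P)\mid v_p(\chi(1))=v_p(|X:P|)\}$; $\operatorname{Irr}^p(X,P)=\operatorname{Irr}(X,P)\setminus\operatorname{Irr}_0(X,P)$; $\mathcal C^p(X,P)=\mathbb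 Z\operatorname{Irr}^p(X,P)$. For a set $S$ of virtual characters, $\pm S=\{\chi,-\chi\mid\chi\in S\}$; a bijection $F\colon\pm S_1\to\pm S_2$ is signed if $F(-\chi)=-F(\chi)$ for all $\chi$. Write ${}^tP=tPt^{-1}$; $\mathcal S(G,P,H)=\{Q\le P\mid Q\subseteq{}^tP\text{ for some }t\in G\setminus H\}$. For a family $\mathcal S$ of subgroups of $P$ closed under taking subgroups, and a finite group $X\ge P$, $\mathcal I(X,P,\mathcal S)$ is the subgroup of $\mathcal C(X)$ spanned by all $\operatorname{Ind}_L^X\phi$ with $\phi\in\mathcal C(L)$, $L\le X$, $L\cap P$ a Sylow $p$-subgroup of $L$ and $L\cap P\in\mathcal S$. With $\mathcal S=\mathcal S(G,P,H)$, a signed bijection $F\colon\pm\operatorname{Irr}_0(G,P)\to\pm\operatorname{Irr}_0(H,P)$ witnesses (WIRC) if $F(\chi)\equiv\operatorname{Proj}_P\operatorname{Res}^G_H\chi\bmod\mathcal C^p(H,P)+\mathcal I(H,P,\mathcal S)$ for all $\chi\in\operatorname{Irr}_0(G,P)$, and witnesses (WIRC* ) if $\chi\equiv\operatorname{Ind}_H^GF(\chi)\bmod\mathcal C^p(G,P)+\mathcal I(G,P,\mathcal S)$ for all $\chi\in\operatorname{Irr}_0(G,P)$. *)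

(* Defs.v *)
From HB Require Import structures.
From mathcomp Require Import all_boot all_order all_algebra all_fingroup.
From mathcomp Require Import all_solvable all_field all_character.
From mathcomp Require Import boolp classical_sets functions.

Set Implicit Arguments.
Unset Strict Implicit.
Unset Printing Implicit Defensive.

Import Order.TTheory GRing.Theory Num.Theory.

Local Open Scope ring_scope.

Section DVR.
Variable O : idomainType.

Definition divides (x y : O) : Prop := exists z : O, y = z * x.

Definition uniformizer (pi : O) : Prop :=
  [/\ pi != 0, pi \isn't a GRing.unit
    & forall x : O, x != 0 ->
        exists (u : O) (n : nat), u \is a GRing.unit /\ x = u * pi ^+ n].

Definition adic_complete (pi : O) : Prop :=
  forall a : nat -> O,
    (forall N : nat, exists M : nat, forall i j : nat,
       (M <= i)%N -> (M <= j)%N -> divides (pi ^+ N) (a i - a j)) ->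
    exists l : O, forall N : nat, exists M : nat, forall i : nat,
      (M <= i)%N -> divides (pi ^+ N) (a i - l).

Definition complete_dvr : Prop :=
  exists2 pi : O, uniformizer pi & adic_complete pi.

End DVR.

(* The fraction field K of [ms_O] is [{fraction ms_O}]; the residue field is
   given through a surjection [ms_red] whose kernel is the maximal ideal.
   MathComp's characters take values in [algC].  "Viewing them as K-valued"
   means fixing an identification of a field of algebraic numbers inside [algC]
   with a subfield of K; this is the pair of embeddings of [ms_E].  One cannot
   take [ms_E] to be [algC], since a discretely valued K does not contain all
   algebraic numbers. *)
Record modular_system (p : nat) := ModularSystem {
  ms_O : idomainType;
  ms_k : closedFieldType;
  ms_red : {rmorphism ms_O -> ms_k};
  ms_E : fieldType;
  ms_EC : {rmorphism ms_E -> algC};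
  ms_EK : {rmorphism ms_E -> {fraction ms_O}};
  ms_complete : complete_dvr ms_O;
  ms_char0 : [pchar ms_O] =i pred0;
  ms_charp : p \in [pchar ms_k];
  ms_red_surj : forall y : ms_k, exists x : ms_O, ms_red x = y;
  ms_red_ker : forall x : ms_O, (ms_red x == 0) = (x \isn't a GRing.unit)
}.

Definition has_roots_of_unity (p : nat) (M : modular_system p) (n : nat) : Prop :=
  exists z : ms_E M, n.-primitive_root z.

(* 0 if z is not in the image
   of [ms_EC]; character values of groups of order dividing n are in this image
   when M has primitive n-th roots of unity *)
Definition toK (p : nat) (M : modular_system p) (z : algC) : {fraction ms_O M} :=
  ms_EK M (xget 0 (fun x : ms_E M => ms_EC M x = z)).

(* Elements of the group algebra RX, for X a subgroup of the ambient finite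
   group gT, are functions gT -> R vanishing outside X. *)
Section GroupAlgebra.
Variables (R : comNzRingType) (gT : finGroupType).
Implicit Types (a b c : {ffun gT -> R}) (X D : {group gT}).

Definition in_galg X a : Prop := forall x : gT, x \notin X -> a x = 0.

Definition gmul a b : {ffun gT -> R} :=
  [ffun g => \sum_(x : gT) a x * b (x^-1 * g)%g].

Definition in_center X a : Prop :=
  in_galg X a /\ forall c, in_galg X c -> gmul a c = gmul c a.

Definition central_idem X a : Prop := in_center X a /\ gmul a a = a.

Definition is_block X b : Prop :=
  [/\ central_idem X b, b <> 0
    & forall b1 b2, central_idem X b1 -> central_idem X b2 ->
        gmul b1 b2 = 0 -> b = b1 + b2 -> b1 = 0 \/ b2 = 0].

Definition fixed_by D a : Prop :=
  forall x g : gT, x \in D -> a (g ^ x)%g = a g.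

(* Tr_D^X(a) is the sum of x a x^-1 over representatives x of the cosets xD;
   the coefficient of x a x^-1 at g is a (x^-1 g x) *)
Definition rel_trace D X a : {ffun gT -> R} :=
  [ffun g => \sum_(C in lcosets D X) a (g ^ repr C)%g].

Definition rel_projective X b D : Prop :=
  D \subset X /\ exists a, [/\ in_galg X a, fixed_by D a & b = rel_trace D X a].

Definition is_defect_group X b D : Prop :=
  rel_projective X b D /\
  forall Q : {group gT}, Q \subset D -> rel_projective X b Q -> Q :=: D.

End GroupAlgebra.

Definition deg (gT : finGroupType) (X : {group gT}) (phi : 'CF(X)) : int :=
  Num.floor (phi 1%g).

Definition vp (p : nat) (a : int) : nat := logn p `|a|%N.

(* signed: (- a)_p' = - a_p' *)
Definition p'part (p : nat) (a : int) : int := sgz a * (`|a|%N`_p^')%:Z.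

Section Blocks.
Variables (p : nat) (M : modular_system p) (gT : finGroupType).
Implicit Types (X H P : {group gT}) (b e : {ffun gT -> ms_O M}).

Definition cfun_eval X (phi : 'CF(X)) b : {fraction ms_O M} :=
  \sum_(x in X) tofrac (b x) * toK M (phi x).

Definition IrrB X b : {set Iirr X} := [set i | cfun_eval 'chi_i b != 0]%SET.

Definition Irr0B X b : {set Iirr X} :=
  [set i in IrrB X b | `[< exists2 D : {group gT}, is_defect_group X b D
                         & vp p (deg 'chi_i) = logn p #|X : D|%g >]]%SET.

Definition Mcount X b (l : int) : nat :=
  #|[set i in Irr0B X b | (p'part p (deg 'chi_i) == l %[mod p])%Z
                       || (p'part p (deg 'chi_i) == - l %[mod p])%Z]%SET|.

Definition IrrP X P : {set Iirr X} :=
  [set i | `[< exists b, [/\ is_block X b,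
      exists2 D : {group gT}, is_defect_group X b D & D \subset P
      & i \in IrrB X b] >]]%SET.

Definition Irr0P X P : {set Iirr X} :=
  [set i in IrrP X P | vp p (deg 'chi_i) == logn p #|X : P|%g]%SET.

Definition IrrpP X P : {set Iirr X} := (IrrP X P :\: Irr0P X P)%SET.

Definition ProjP X P (phi : 'CF(X)) : 'CF(X) :=
  \sum_(i in IrrP X P) '[phi, 'chi_i] *: 'chi_i.

Definition CpP X P : {pred 'CF(X)} := 'Z[[seq 'chi_i | i in IrrpP X P]]%g.

(* Br_P : (OX)^P -> k C_X(P) *)
Definition Br X P b : {ffun gT -> ms_k M} :=
  [ffun g => if g \in 'C_X(P)%g then ms_red M (b g) else 0].

(* For a block b of G with defect group P and N_G(P) <= H <= G, the Brauer
   correspondent of b in H is the block of H with defect group P having the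
   same image under Br_P; note that C_G(P) = C_H(P). *)
Definition Brauer_correspondent (G H P : {group gT}) b e : Prop :=
  [/\ is_block H e, is_defect_group H e P & Br H P e = Br G P b].

End Blocks.

Arguments CpP {p} M {gT} X P _.
Arguments ProjP {p} M {gT X} P phi.

Definition Zspan (V : zmodType) (S : set V) : set V :=
  fun v => exists (n : nat) (c : 'I_n -> int) (g : 'I_n -> V),
    (forall i, S (g i)) /\ v = \sum_(i < n) g i *~ c i.

Definition pm (gT : finGroupType) (X : {group gT}) (A : {set Iirr X}) :
    set 'CF(X) :=
  fun phi => exists2 i, i \in A & phi = 'chi_i \/ phi = - 'chi_i.

(* t P t^-1 is P :^ t^-1 in MathComp *)
Definition SGPH (gT : finGroupType) (G P H : {group gT}) : {set {group gT}} :=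
  [set Q : {group gT} | (Q \subset P) &&
     [exists t in (G :\: H)%SET, Q \subset (P :^ t^-1)%g]]%SET.

Definition IXPS (p : nat) (gT : finGroupType) (X P : {group gT})
    (S : {set {group gT}}) : set 'CF(X) :=
  Zspan (fun psi : 'CF(X) => exists (L : {group gT}) (phi : 'CF(L)),
    [/\ L \subset X, (p.-Sylow(L) (L :&: P))%g, (L :&: P)%G \in S,
        phi \in 'Z[irr L]%g & psi = 'Ind[X] phi]).

Arguments IXPS p {gT} X P S _.
Arguments SGPH {gT} G P H.
Arguments pm {gT X} A _.

Section WIRC.
Variables (p : nat) (M : modular_system p) (gT : finGroupType).
Variables (G P H : {group gT}).
Implicit Types F : 'CF(G) -> 'CF(H).

Definition congCI (X : {group gT}) (phi psi : 'CF(X)) : Prop :=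
  exists c i : 'CF(X), [/\ c \in CpP M X P, IXPS p X P (SGPH G P H) i
                         & phi - psi = c + i].

Definition signed_bijection F : Prop :=
  set_bij (pm (Irr0P M G P)) (pm (Irr0P M H P)) F /\
  forall phi, pm (Irr0P M G P) phi -> F (- phi) = - F phi.

Definition witnesses_WIRC F : Prop :=
  forall i : Iirr G, i \in Irr0P M G P ->
    congCI (F 'chi_i) (ProjP M P ('Res[H] 'chi_i)).

Definition witnesses_WIRCstar F : Prop :=
  forall i : Iirr G, i \in Irr0P M G P ->
    congCI 'chi_i ('Ind[G] (F 'chi_i)).

End WIRC.

(* Main.v *)
Require Import Defs.
From mathcomp Require Import all_boot all_order all_algebra all_fingroup.
From mathcomp Require Import all_solvable all_field all_character.
From mathcomp Require Import ring.
From mathcomp Require generic_quotient boolp classical_sets functions.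

Set Implicit Arguments.
Unset Strict Implicit.
Unset Printing Implicit Defensive.

Import Order.TTheory GRing.Theory Num.Theory.

Local Open Scope ring_scope.

(** Write [m] for the maximal ideal of [O], [X] for a finite group containing
the p-group [P], and evaluate class functions on group algebras by linearity.
The whole argument consists in evaluating the congruences of the hypothesis at
central elements of group algebras, modulo [|X:P| m].

If [z] is central in [O X], every class function in [C^p(X,P)] and every one in
[I(X,P,S)], where [P] is not in [S], takes at [z] a value in [|X:P| m]
([CpP_negligible], [IXPS_negligible]): for an irreducible [theta] in
[Irr^p(X,P)], [theta(z)] is [theta(1)] times the integral element
[omega_theta(z)] and [theta(1)/|X:P|] is in [m]; for a character induced from
[L], the value at [z] is a multiple of [|X:L|], and [|X:L|/|X:P|] is in [m]
because [L :&: P] is smaller than [P].  The family [S(G,P,H)] does not contain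
[P], since [N_G(P)] lies in [H].

On the other hand, if [chi] lies in a block [f] which is the trace from [P] to
[X] of some [a], then [chi(z) chi(a) = chi(za) chi(1)] and
[chi(1) = |X:P| chi(a)], so that [chi(z) = |X:P| chi(za)].  As [za] is fixed by
[P], its value under [chi] is modulo [m] a sum over [C_X(P)].  Hence [chi(z)]
is in [|X:P| m] as soon as [Br_P(z) = 0] ([in_max_eval_center]): modulo
[|X:P| m], [chi(z)] depends only on [Br_P(z)].

Now let [e] be the Brauer correspondent of [b] and [chi] in [Irr_0(G,P)].  Then
[chi(b) = |G:H| F(chi)(e)] modulo [|G:P| m] ([witness_eval_congr]).
  - If the congruence concerns [Res chi], then [F(chi)(e) = chi(e)] modulo
    [|H:P| m], and [|G:H| chi(e) = chi(t)] where [t] is the trace to [G] of an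
    element whose trace from [P] to [H] is [e]; moreover [Br_P(t)], [Br_P(e)]
    and [Br_P(b)] are equal.
  - If it concerns [Ind F(chi)], then [chi(b) = |G:H| F(chi)(b)] modulo
    [|G:P| m], where [b] is restricted to [H]; this restriction is central in
    [O H] and has the same image as [e] under [Br_P].
Since [chi(b)] is [0] or [chi(1)], and [F(chi)(e)] is [0] or [F(chi)(1)], and
[chi(1)] and [|G:H| F(chi)(1)] have the same p-part as [|G:P|], it follows that
[chi] is in [b] if and only if [F(chi)] is in [e] up to sign, and then the
degrees satisfy the stated congruence ([witness_transfer]).  The equality of
the numbers [M_l] follows, as [F] is a bijection.

Finally, the height of [chi] in [b] is defined by some defect group of [b],
which must be compared with [P].  That two defect groups of a block have the
same order ([card_defect_group]) is proved by characters: some class sum has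
both a nonzero coefficient in [b] modulo [m] and a nonzero central character
modulo [m].  The second property makes the class sum invertible in the block
([block_local]), so that [b] is a trace from a Sylow subgroup [Q] of a
centralizer; the first one forces [Q] into a conjugate of any subgroup from
which [b] is a trace. *)

(** * The valuation ring and its maximal ideal *)

Lemma divf_expr (F : fieldType) (u v q : F) m n : q != 0 -> (m <= n)%N ->
  u * q ^+ n / (v * q ^+ m) = u * v^-1 * q ^+ (n - m).
Proof.
move=> q0 le_mn; rewrite -{1}(subnK le_mn) exprD -mulf_div mulfK //.
by rewrite expf_neq0.
Qed.

Section ValuationRing.
Variables (p : nat) (M : modular_system p).
Local Notation O := (ms_O M).
Local Notation K := {fraction (ms_O M)}.
Local Notation red := (ms_red M).
Implicit Types (x y : K) (a b : O).

Definition inO x := exists a, x = tofrac a.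
Definition in_max x := exists2 a, red a = 0 & x = tofrac a.

Lemma inO_tofrac a : inO (tofrac a).
Proof. by exists a. Qed.

Lemma inON x : inO x -> inO (- x).
Proof. by case=> a ->; exists (- a); rewrite rmorphN. Qed.

Lemma inOD x y : inO x -> inO y -> inO (x + y).
Proof. by move=> [a ->] [b ->]; exists (a + b); rewrite rmorphD. Qed.

Lemma inOB x y : inO x -> inO y -> inO (x - y).
Proof. by move=> Ox Oy; apply: inOD => //; apply: inON. Qed.

Lemma inOM x y : inO x -> inO y -> inO (x * y).
Proof. by move=> [a ->] [b ->]; exists (a * b); rewrite rmorphM. Qed.

Lemma inO_nat n : inO n%:R.
Proof. by exists n%:R; rewrite rmorph_nat. Qed.

Lemma inO_int (n : int) : inO n%:~R.
Proof. by exists n%:~R; rewrite rmorph_int. Qed.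

Lemma inOX x n : inO x -> inO (x ^+ n).
Proof. by case=> a ->; exists (a ^+ n); rewrite rmorphXn. Qed.

Lemma inO_sum (I : Type) (r : seq I) (P : pred I) (f : I -> K) :
  (forall i, P i -> inO (f i)) -> inO (\sum_(i <- r | P i) f i).
Proof.
move=> Of; elim/big_rec: _ => [|i x Pi Ox]; first exact: (inO_nat 0).
by apply: inOD => //; apply: Of.
Qed.

Lemma in_max_tofrac a : in_max (tofrac a) <-> red a = 0.
Proof.
split=> [[b rb /eqP]|ra]; last by exists a.
by rewrite tofrac_eq => /eqP ->.
Qed.

Lemma in_max_inO x : in_max x -> inO x.
Proof. by case=> a _ ->; apply: inO_tofrac. Qed.

Lemma in_max0 : in_max 0.
Proof. by exists 0; rewrite rmorph0. Qed.

Lemma not_in_max1 : ~ in_max 1.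
Proof.
by rewrite -(rmorph1 (@tofrac O)) in_max_tofrac rmorph1 => /eqP; rewrite oner_eq0.
Qed.

Lemma in_maxN x : in_max x -> in_max (- x).
Proof. by case=> a ra ->; exists (- a); rewrite rmorphN ?ra ?oppr0. Qed.

Lemma in_maxD x y : in_max x -> in_max y -> in_max (x + y).
Proof.
by move=> [a ra ->] [b rb ->]; exists (a + b); rewrite rmorphD ?ra ?rb ?addr0.
Qed.

Lemma in_maxMl x y : inO x -> in_max y -> in_max (x * y).
Proof.
by move=> [a ->] [b rb ->]; exists (a * b); rewrite rmorphM ?rb ?mulr0.
Qed.

Lemma in_maxMr x y : in_max x -> inO y -> in_max (x * y).
Proof. by move=> sx Oy; rewrite mulrC; apply: in_maxMl. Qed.

Lemma in_max_sum (I : Type) (r : seq I) (P : pred I) (f : I -> K) :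
  (forall i, P i -> in_max (f i)) -> in_max (\sum_(i <- r | P i) f i).
Proof.
move=> Of; elim/big_rec: _ => [|i x Pi Ox]; first exact: in_max0.
by apply: in_maxD => //; apply: Of.
Qed.

Lemma in_maxX x n : in_max x -> (0 < n)%N -> in_max (x ^+ n).
Proof.
by case: n => // n sx _; rewrite exprS; apply/in_maxMr/inOX/in_max_inO.
Qed.

Lemma inOV x : inO x -> ~ in_max x -> inO x^-1.
Proof.
case=> a -> /in_max_tofrac ra; have Ua: a \is a GRing.unit.
  by apply: contra_notT ra; rewrite -ms_red_ker => /eqP.
by exists a^-1; rewrite -(rmorphV (@tofrac O)).
Qed.

Lemma frac_num_den x : exists a b, b != 0 /\ x = tofrac a / tofrac b.
Proof.
elim/generic_quotient.quotW: x => r; exists (frac r).1, (frac r).2.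
split; first exact: denom_ratioP.
have d0 : tofrac (frac r).2 != 0 :> K by rewrite tofrac_eq0 denom_ratioP.
apply: (mulIf d0); rewrite divfK // -{1}[r]Ratio_numden.
unlock tofrac; rewrite -[LHS]FracField.pi_mul; apply/generic_quotient.eqmodP.
by rewrite /= FracField.equivfE /FracField.mulf /= Ratio_numden !numden_Ratio
  ?mulr1 ?mulf_neq0 ?oner_eq0 ?denom_ratioP // mulrC.
Qed.

(** Valuation ring property, read off from the factorization by a
uniformizer. *)
Lemma inO_or_in_max_inv x : inO x \/ in_max x^-1.
Proof.
have [a [b [b0 ->]]] := frac_num_den x.
have [pi [pi0 npi fact] _] := ms_complete M.
have [->|a0] := eqVneq a 0.
  by left; rewrite rmorph0 mul0r; apply: (inO_nat 0).
have rpi: red pi = 0 by apply/eqP; rewrite ms_red_ker.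
have [u [n [Uu ->]]] := fact a a0; have [v [m [Uv ->]]] := fact b b0.
have fpi0: tofrac pi != 0 :> K by rewrite tofrac_eq0.
have fu0: tofrac u != 0 :> K.
  by rewrite tofrac_eq0; apply: contraTneq Uu => ->; rewrite unitr0.
have fv0: tofrac v != 0 :> K.
  by rewrite tofrac_eq0; apply: contraTneq Uv => ->; rewrite unitr0.
case: (leqP m n) => [le_mn|lt_nm]; [left|right].
  exists (u * v^-1 * pi ^+ (n - m)).
  rewrite !rmorphM !rmorphXn (rmorphV _ Uv) /=.
  exact: divf_expr.
exists (v * u^-1 * pi ^+ (m - n)).
  by rewrite rmorphM rmorphXn rpi expr0n subn_eq0 leqNgt lt_nm mulr0.
rewrite !rmorphM !rmorphXn (rmorphV _ Uu) /=.
by rewrite invf_div divf_expr // ltnW.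
Qed.

Lemma in_maxX_div x y : in_max x -> y != 0 -> exists n, inO (x ^+ n.+1 / y).
Proof.
have [pi [pi0 npi fact] _] := ms_complete M.
have fpi0: tofrac pi != 0 :> K by rewrite tofrac_eq0.
move=> [c rc ->] y0; case: (inO_or_in_max_inv y) => [[d dE]|sy]; last first.
  by exists 0%N; apply: inOM; [apply/inOX/inO_tofrac | apply: in_max_inO].
rewrite {y}dE tofrac_eq0 in y0 *.
have [v [m [Uv ->]]] := fact d y0.
have fv0: tofrac v != 0 :> K.
  by rewrite tofrac_eq0; apply: contraTneq Uv => ->; rewrite unitr0.
have [c' ->]: exists c', c = c' * pi.
  have [->|c0] := eqVneq c 0; first by exists 0; rewrite mul0r.
  have [u [[|n] [Uu cE]]] := fact c c0.
    by move/eqP: rc; rewrite ms_red_ker cE mulr1 Uu.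
  by exists (u * pi ^+ n); rewrite -mulrA -exprSr.
exists m, (c' ^+ m.+1 * pi * v^-1).
rewrite !(rmorphM, rmorphXn) (rmorphV _ Uv) /= exprMn.
by rewrite divf_expr // subSnn mulrAC.
Qed.

(** An element of [K] all of whose powers have a common denominator is
integral; this applies to the values of central characters. *)
Lemma inO_bounded x y :
  y != 0 -> (forall n, inO (y * x ^+ n)) -> inO x.
Proof.
move=> y0 Ox; case: (inO_or_in_max_inv x) => // sx.
have [->|x0] := eqVneq x 0; first exact: (inO_nat 0).
have [n On] := in_maxX_div sx y0.
suff -> : x = y * x ^+ n.+2 * (x^-1 ^+ n.+1 / y) by apply: inOM.
rewrite exprVn [x ^+ n.+2]exprS [y * (x * _)]mulrCA -invfM [_ * y]mulrC.
by rewrite mulfK // mulf_neq0 ?expf_neq0.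
Qed.

Lemma inO_unity_root x n : (0 < n)%N -> x ^+ n = 1 -> inO x.
Proof.
move=> n_gt0 xn1; case: (inO_or_in_max_inv x) => // /in_maxX/(_ n_gt0).
by rewrite exprVn xn1 invr1 => /not_in_max1.
Qed.

Lemma natK_eq0 n : (n%:R == 0 :> K) = (n == 0)%N.
Proof.
rewrite -(rmorph_nat (@tofrac O)) tofrac_eq0.
by have /pcharf0P -> := ms_char0 M.
Qed.

Lemma in_max_int (n : int) : in_max n%:~R <-> (p %| n)%Z.
Proof.
rewrite -(rmorph_int (@tofrac O)) in_max_tofrac rmorph_int.
by rewrite (dvdz_pcharf (ms_charp M)); split=> [->|/eqP].
Qed.

Lemma ms_prime : prime p.
Proof. exact: pcharf_prime (ms_charp M). Qed.

Lemma in_max_nat n : in_max n%:R <-> (p %| n)%N.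
Proof. by rewrite (in_max_int n). Qed.

Lemma ratio_partn m n : (0 < n)%N -> (n`_p %| m)%N ->
  m%:R / n%:R = (m %/ n`_p)%:R / (n`_p^')%:R :> K.
Proof.
move=> n_gt0 /dvdnP[k ->]; rewrite mulnK ?part_gt0 //.
rewrite -{2}(partnC p n_gt0) [(_ * n`_p^')%N]mulnC !natrM -mulf_div.
by rewrite divff ?mulr1 // natK_eq0 -lt0n part_gt0.
Qed.

Lemma inO_natV n : (p^').-nat n -> inO n%:R^-1.
Proof.
move=> p'n; apply: inOV; first exact: inO_nat.
by rewrite in_max_nat; move: p'n; rewrite p'natE ?ms_prime // => /negP.
Qed.

Lemma inO_ratio m n :
  (0 < m)%N -> (0 < n)%N -> (logn p n <= logn p m)%N -> inO (m%:R / n%:R).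
Proof.
move=> m_gt0 n_gt0 le_nm.
have n_m : (n`_p %| m)%N by rewrite p_part pfactor_dvdn ?ms_prime.
rewrite ratio_partn //; apply: inOM; first exact: inO_nat.
by apply: inO_natV; apply: part_pnat.
Qed.

Lemma in_max_ratio m n :
  (0 < m)%N -> (0 < n)%N -> (logn p n < logn p m)%N -> in_max (m%:R / n%:R).
Proof.
move=> m_gt0 n_gt0 lt_nm.
have n_m : (p * n`_p %| m)%N by rewrite p_part -expnS pfactor_dvdn ?ms_prime.
rewrite ratio_partn ?(dvdn_trans (dvdn_mull _ (dvdnn _)) n_m) //; apply: in_maxMr.
  by rewrite in_max_nat dvdn_divRL // (dvdn_trans (dvdn_mull _ (dvdnn _)) n_m).
by apply: inO_natV; apply: part_pnat.
Qed.

(** If [m/n] is integral then [m] has at least the p-adic valuation of [n]; when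
the valuations differ, the quotient is therefore divisible by [p]. *)
Lemma in_max_ratio_of_inO m n : (0 < m)%N -> (0 < n)%N ->
  inO (m%:R / n%:R) -> logn p m != logn p n -> in_max (m%:R / n%:R).
Proof.
move=> m_gt0 n_gt0 Omn; rewrite neq_ltn => /orP[lt_mn|]; last exact: in_max_ratio.
case: not_in_max1; have := in_maxMl Omn (in_max_ratio n_gt0 m_gt0 lt_mn).
by rewrite mulf_div [(_ * m%:R)]mulrC divff // mulf_neq0 // natK_eq0 -lt0n.
Qed.

Lemma not_in_max_ratio m n : (0 < m)%N -> (0 < n)%N ->
  logn p m = logn p n -> ~ in_max (m%:R / n%:R).
Proof.
move=> m_gt0 n_gt0 eq_mn smn; case: not_in_max1.
have := in_maxMr smn (inO_ratio n_gt0 m_gt0 (eq_leq eq_mn)).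
by rewrite mulf_div [(_ * m%:R)]mulrC divff // mulf_neq0 // natK_eq0 -lt0n.
Qed.

End ValuationRing.

(** * Sums over the fixed points of a p-group *)

Section PGroupSum.
Variables (R : nzRingType) (p : nat) (aT : finGroupType) (sT : finType).
Variables (A : {group aT}) (to : action A sT) (Q : {group aT}) (S : {set sT}).

(** The function is constant on orbits, whose lengths are powers of [p].  The
proof counts the level sets of [f], which are stable under the action. *)
Lemma pgroup_sum_fix (f : sT -> R) :
    p \in [pchar R] -> (p.-group Q)%g -> [acts Q, on S | to]%g ->
    {in S & Q, forall x q, f (to x q) = f x} ->
  \sum_(x in S) f x = \sum_(x in ('Fix_(S | to)(Q))%g) f x.
Proof.
move=> pR pQ actsQ fQ.
have level (B : {set sT}) : B \subset S ->
    \sum_(x in B) f x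
      = \sum_(v <- undup [seq f x | x in S]) v *+ #|[set x in B | f x == v]|.
  move=> sBS; transitivity (\sum_(x in B) \sum_(v <- undup [seq f x | x in S])
                               (if f x == v then v else 0)).
    apply: eq_bigr => x Bx; rewrite (bigD1_seq (f x)) ?undup_uniq //=; last first.
      by rewrite mem_undup image_f // (subsetP sBS).
    by rewrite eqxx big1 ?addr0 // => v; rewrite eq_sym => /negPf ->.
  rewrite exchange_big /=; apply: eq_bigr => v _.
  by rewrite -big_mkcondr /= -sumr_const; apply: eq_bigl => x; rewrite inE.
rewrite !level ?subsetIl //; apply: eq_bigr => v _.
have -> : [set x in ('Fix_(S | to)(Q))%g | f x == v]
          = ('Fix_([set x in S | f x == v] | to)(Q))%g.
  by apply/setP=> x; rewrite !inE andbAC.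
have actsv : [acts Q, on [set x in S | f x == v] | to]%g.
  apply/subsetP=> q Qq; rewrite !inE (subsetP (acts_dom actsQ)) //=.
  apply/subsetP=> x; rewrite !inE => /andP[Sx fx].
  by rewrite (acts_act actsQ) ?Sx ?fQ.
rewrite -!(mulr_natr v) -[in LHS](GRing.natr_mod_pchar pR) (pgroup_fix_mod pQ actsv).
by rewrite GRing.natr_mod_pchar.
Qed.
End PGroupSum.

(** * Centres and relative traces in a group algebra *)

Section ClassFunctions.
Variables (R : comNzRingType) (gT : finGroupType).
Implicit Types (a b c z : {ffun gT -> R}) (X D : {group gT}) (x g t : gT).

Lemma gmulE a c g : gmul a c g = \sum_x a x * c (x^-1 * g)%g.
Proof. exact: ffunE. Qed.

(** Commuting with the group elements of [X] already makes the coefficients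
constant on conjugacy classes. *)
Lemma gcenter_conj X z g t : in_center X z -> t \in X -> z (g ^ t)%g = z g.
Proof.
move=> [_ /(_ [ffun x => (x == t)%:R]) cz] Xt.
have /ffunP/(_ (g * t)%g) :
    gmul z [ffun x => (x == t)%:R] = gmul [ffun x => (x == t)%:R] z.
  by apply: cz => x; rewrite ffunE; case: eqP => // -> /negP.
rewrite !gmulE (bigD1 g) //= ffunE mulKg eqxx mulr1 big1 => [|x xg]; last first.
  rewrite ffunE; case: eqP => [Dt|_]; last by rewrite mulr0.
  by case/eqP: xg; apply: (mulIg t); rewrite -{1}Dt mulKVg.
rewrite (bigD1 t) //= ffunE eqxx mul1r big1 ?addr0 => [|x xt]; last first.
  by rewrite ffunE (negPf xt) mul0r.
by move->; rewrite conjgE.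
Qed.

Lemma conj_gcenter X z : in_galg X z ->
  (forall g t, t \in X -> z (g ^ t)%g = z g) -> in_center X z.
Proof.
move=> Xz zX; split=> // c Xc; apply/ffunP=> g; rewrite !ffunE.
rewrite (reindex_inj (inj_comp (mulgI g) invg_inj)) /=; apply: eq_bigr => x _.
rewrite invMg invgK mulgKV mulrC.
have [Xx | /Xc->] := boolP (x \in X); last by rewrite !mul0r.
by rewrite -(zX _ _ Xx) conjgE mulgKV.
Qed.

Lemma in_galg_gmul X a c : in_galg X a -> in_galg X c -> in_galg X (gmul a c).
Proof.
move=> Xa Xc g X'g; rewrite ffunE big1 // => x _.
have [Xx | /Xa->] := boolP (x \in X); last by rewrite mul0r.
by rewrite Xc ?mulr0 // groupMl ?groupV.
Qed.

Lemma gmul_conj a c g t :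
  (forall x, a (x ^ t)%g = a x) -> (forall x, c (x ^ t)%g = c x) ->
  gmul a c (g ^ t)%g = gmul a c g.
Proof.
move=> aX cX; rewrite !ffunE (reindex_inj (conjg_inj t)) /=.
by apply: eq_bigr => x _; rewrite aX -conjVg -conjMg cX.
Qed.

Lemma gcenterM X z y : in_center X z -> in_center X y -> in_center X (gmul z y).
Proof.
move=> Zz Zy; apply: conj_gcenter => [|g t Xt].
  by apply: in_galg_gmul; [case: Zz | case: Zy].
by apply: gmul_conj => x; [apply: (gcenter_conj x Zz) | apply: (gcenter_conj x Zy)].
Qed.

Lemma gcenterD X z y : in_center X z -> in_center X y -> in_center X (z + y).
Proof.
move=> Zz Zy; apply: conj_gcenter => [g X'g|g t Xt]; rewrite !ffunE.
  by rewrite (proj1 Zz) ?(proj1 Zy) ?addr0.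
by rewrite (gcenter_conj g Zz) ?(gcenter_conj g Zy).
Qed.

Definition gscale (k : R) a : {ffun gT -> R} := [ffun g => k * a g].

Lemma gcenterZ X (k : R) z : in_center X z -> in_center X (gscale k z).
Proof.
move=> Zz; apply: conj_gcenter => [g X'g|g t Xt]; rewrite !ffunE.
  by rewrite (proj1 Zz) // mulr0.
by rewrite (gcenter_conj g Zz).
Qed.

Lemma gcenterB X z y : in_center X z -> in_center X y -> in_center X (z - y).
Proof.
move=> Zz Zy; apply: conj_gcenter => [g X'g|g t Xt]; rewrite !ffunE.
  by rewrite (proj1 Zz) ?(proj1 Zy) ?subrr.
by rewrite (gcenter_conj g Zz) ?(gcenter_conj g Zy).
Qed.

Definition galg_one : {ffun gT -> R} := [ffun g => (g == 1%g)%:R].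

Lemma gcenter1 X : in_center X galg_one.
Proof.
apply: conj_gcenter => [g X'g|g t _]; rewrite !ffunE ?conjg_eq1 //.
by case: eqP => // g1; rewrite g1 group1 in X'g.
Qed.

Lemma gcenter_restrict X D z :
  in_center X z -> D \subset X -> in_center D [ffun g => if g \in D then z g else 0].
Proof.
move=> Zz sDX; apply: conj_gcenter => [g D'g|g t Dt]; rewrite !ffunE ?(negPf D'g) //.
by rewrite groupJr // (gcenter_conj g Zz) // (subsetP sDX).
Qed.

(** Summing over [X] instead of over cosets removes the choice of
representatives, at the price of the factor [|D|]; over [O] this factor can be
cancelled. *)
Lemma rel_trace_sum D X a g : D \subset X -> fixed_by D a ->
  #|D|%:R * rel_trace D X a g = \sum_(t in X) a (g ^ t)%g.
Proof.
move=> sDX aD; rewrite ffunE mulr_sumr.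
rewrite [RHS](partition_big (fun t => t *: D)%g [in lcosets D X]) /= => [|t Xt];
  last first.
  by apply/lcosetsP; exists t.
apply: eq_bigr => _ /lcosetsP[x Xx ->].
rewrite -(card_lcoset D x) mulr_natl -sumr_const.
apply: eq_big => [t|t /lcosetP[d Dd ->]].
  apply/idP/andP=> [xDt|[_ /eqP <-]]; last exact: lcoset_refl.
  split; last by apply/eqP/lcoset_eqP.
  by case/lcosetP: xDt => d Dd ->; rewrite groupM // (subsetP sDX).
have /lcosetP[d' Dd' ->] : repr (x *: D)%g \in (x *: D)%g.
  exact: mem_repr (lcoset_refl _ _).
by rewrite !conjgM (aD d') ?(aD d).
Qed.

(** Right cosets carry the action by right translation, which serves to reduce
traces modulo [p]. *)
Lemma rel_trace_rcosets D X a g : D \subset X -> fixed_by D a ->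
  rel_trace D X a g = \sum_(C in rcosets D X) a (g ^ (repr C)^-1)%g.
Proof.
move=> sDX aD.
have lr (C : {set gT}) : (C^-1 \in lcosets D X)%g = (C \in rcosets D X)%g.
  apply/lcosetsP/rcosetsP=> -[x Xx].
    move/(congr1 invg); rewrite invgK => ->.
    by exists x^-1%g; rewrite ?groupV ?invg_lcoset.
  by move->; exists x^-1%g; rewrite ?groupV ?invg_rcoset.
rewrite ffunE (reindex_inj invg_inj) /=; apply: eq_big => [//|C].
rewrite lr => /rcosetsP[x Xx ->].
have /rcosetP[d Dd ->] : repr (D :* x)%g \in (D :* x)%g.
  exact: mem_repr (rcoset_refl _ _).
have /lcosetP[d' Dd' ->] : repr ((D :* x)^-1)%g \in (x^-1 *: D)%g.
  by rewrite invg_rcoset; apply: mem_repr (lcoset_refl _ _).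
by rewrite invMg !conjgM (aD d') ?(aD d^-1)%g ?groupV.
Qed.

End ClassFunctions.

(** * Carrying character values into K *)

Section Liftable.
Variables (p : nat) (M : modular_system p).
Local Notation EC := (ms_EC M).
Local Notation EK := (ms_EK M).
Local Notation toK := (toK M).

(** The map [toK] respects the field operations only on the image of [ms_EC],
as it takes a default value elsewhere. *)
Definition liftable (z : algC) := exists y, EC y = z.

Lemma toK_EC y : toK (EC y) = EK y.
Proof.
rewrite /Defs.toK; congr (EK _); apply: (fmorph_inj EC).
by apply: (@classical_sets.xgetPex _ 0 (fun x => EC x = EC y)); exists y.
Qed.

Lemma liftableD u v : liftable u -> liftable v -> liftable (u + v).
Proof. by move=> [x <-] [y <-]; exists (x + y); rewrite rmorphD. Qed.

Lemma liftableN u : liftable u -> liftable (- u).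
Proof. by move=> [x <-]; exists (- x); rewrite rmorphN. Qed.

Lemma liftableM u v : liftable u -> liftable v -> liftable (u * v).
Proof. by move=> [x <-] [y <-]; exists (x * y); rewrite rmorphM. Qed.

Lemma liftableV u : liftable u -> liftable u^-1.
Proof. by move=> [x <-]; exists x^-1; rewrite fmorphV. Qed.

Lemma liftable_nat n : liftable n%:R.
Proof. by exists n%:R; rewrite rmorph_nat. Qed.

Lemma liftable_sum (I : Type) (r : seq I) (P : pred I) (f : I -> algC) :
  (forall i, P i -> liftable (f i)) -> liftable (\sum_(i <- r | P i) f i).
Proof.
move=> fE; elim/big_rec: _ => [|i u Pi]; first exact: (liftable_nat 0).
by apply: liftableD; apply: fE.
Qed.

Lemma toKD u v : liftable u -> liftable v -> toK (u + v) = toK u + toK v.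
Proof. by move=> [x <-] [y <-]; rewrite -rmorphD !toK_EC rmorphD. Qed.

Lemma toKN u : liftable u -> toK (- u) = - toK u.
Proof. by move=> [x <-]; rewrite -rmorphN !toK_EC rmorphN. Qed.

Lemma toKM u v : liftable u -> liftable v -> toK (u * v) = toK u * toK v.
Proof. by move=> [x <-] [y <-]; rewrite -rmorphM !toK_EC rmorphM. Qed.

Lemma toKV u : liftable u -> toK u^-1 = (toK u)^-1.
Proof. by move=> [x <-]; rewrite -fmorphV !toK_EC fmorphV. Qed.

Lemma toK_nat n : toK n%:R = n%:R.
Proof. by rewrite -(rmorph_nat EC) toK_EC rmorph_nat. Qed.

Lemma toK_int (n : int) : toK n%:~R = n%:~R.
Proof. by rewrite -(rmorph_int EC) toK_EC rmorph_int. Qed.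

Lemma toK_sum (I : Type) (r : seq I) (P : pred I) (f : I -> algC) :
  (forall i, P i -> liftable (f i)) ->
  toK (\sum_(i <- r | P i) f i) = \sum_(i <- r | P i) toK (f i).
Proof.
move=> fE; suff [] : liftable (\sum_(i <- r | P i) f i) /\ 
  toK (\sum_(i <- r | P i) f i) = \sum_(i <- r | P i) toK (f i) by [].
elim/big_rec2: _ => [|i u v Pi [vE uE]].
  by rewrite (toK_nat 0); split=> //; apply: (liftable_nat 0).
by have fi := fE i Pi; rewrite toKD // uE; split=> //; apply: liftableD.
Qed.

End Liftable.

(** The sum of the conjugates of [x] acts as a scalar in an irreducible
representation; the scalar is found by taking the trace. *)
Lemma irr_mul_class_sum (gT : finGroupType) (X : {group gT}) (i : Iirr X) x y :
  x \in X -> y \in X ->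
  \sum_(t in X) 'chi_i (x ^ t * y)%g = #|X|%:R * 'chi_i x * 'chi_i y / 'chi_i 1%g.
Proof.
move=> Xx Xy; have rE g : g \in X -> 'chi_i g = \tr ('Chi_i g).
  by move=> Xg; rewrite -irrRepr cfunE Xg.
pose S := \sum_(t in X) 'Chi_i (x ^ t)%g.
have cS : centgmx 'Chi_i S.
  apply/centgmxP=> g Xg; rewrite mulmx_sumr mulmx_suml.
  rewrite (reindex_inj (mulIg (g^-1)%g)) /=.
  apply: eq_big => [t|t]; rewrite ?groupMr ?groupV // => Xt.
  rewrite -!repr_mxM ?groupJ ?groupM ?groupV //; congr ('Chi_i _).
  by rewrite conjgM [((x ^ t) ^ _)%g]conjgE invgK -mulgA mulgKV.
have /is_scalar_mxP[e Se] : is_scalar_mx S.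
  apply: mx_abs_irr_cent_scalar cS; apply: groupC; exact: socle_irr.
have trS : #|X|%:R * 'chi_i x = e * 'chi_i 1%g.
  have := congr1 mxtrace Se; rewrite raddf_sum /= mxtrace_scalar.
  rewrite (eq_bigr (fun=> 'chi_i x)) => [|t Xt]; last first.
    by rewrite -rE ?groupJ // cfunJ.
  by rewrite sumr_const mulr_natl -irrRepr cfRepr1 mulr_natr => ->.
transitivity (\tr (S *m 'Chi_i y)).
  rewrite mulmx_suml raddf_sum; apply: eq_bigr => t Xt.
  have Xxt : (x ^ t)%g \in X by rewrite groupJ.
  by rewrite rE ?(groupM Xxt) // repr_mxM.
by rewrite Se mul_scalar_mx mxtraceZ -rE // trS mulrAC mulfK ?irr1_neq0.
Qed.

(** * Evaluation of characters on group algebras *)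

Section Evaluation.
Variables (p : nat) (M : modular_system p) (gT : finGroupType) (X : {group gT}).
Hypothesis rX : has_roots_of_unity M #|X|.
Local Notation O := (ms_O M).
Local Notation K := {fraction (ms_O M)}.
Local Notation toK := (toK M).
Local Notation eval := (@cfun_eval p M gT X).
Implicit Types (i j : Iirr X) (phi psi : 'CF(X)) (a b c z : {ffun gT -> O}).

(** The eigenvalues of [x] are roots of unity of order dividing [|X|], and the
roots of unity of [ms_E] account for all of them. *)
Lemma irr_roots i x : x \in X -> exists n (e : 'I_n -> ms_E M),
  (forall k, e k ^+ #|X| = 1) /\ 'chi_i x = \sum_k ms_EC M (e k).
Proof.
move=> Xx; have [w prim_w] := rX; rewrite -irrRepr.
have [e [_ [e1 _] [-> _] _]] := repr_rsim_diag 'Chi_i Xx.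
have /fin_all_exists[f Df] k : exists y, y ^+ #|X| = 1 /\ e 0 k = ms_EC M y.
  have ek : e 0 k ^+ #|X| = 1.
    by have /dvdnP[q ->] := order_dvdG Xx; rewrite mulnC exprM e1 expr1n.
  have prim_z : #|X|.-primitive_root (ms_EC M w) by rewrite fmorph_primitive_root.
  have [m ->] := prim_rootP prim_z ek.
  exists (w ^+ m); rewrite rmorphXn /=; split=> //.
  by rewrite exprAC (prim_expr_order prim_w) expr1n.
exists _, f; split=> [k|]; first by case: (Df k).
by apply: eq_bigr => k _; case: (Df k).
Qed.

Lemma irr_liftable i x : liftable M ('chi_i x).
Proof.
have [Xx | X'x] := boolP (x \in X); last by rewrite cfun0 //; apply: (liftable_nat M 0).
have [n [e [_ ->]]] := irr_roots i Xx.
by apply: liftable_sum => k _; exists (e k).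
Qed.

Lemma irr_inO i x : inO (toK ('chi_i x)).
Proof.
have [Xx | X'x] := boolP (x \in X); last first.
  by rewrite cfun0 // (toK_nat M 0); exists 0; rewrite rmorph0.
have [n [e [e1 ->]]] := irr_roots i Xx.
rewrite toK_sum => [|k _]; last by exists (e k).
apply: inO_sum => k _; rewrite toK_EC.
by apply: (@inO_unity_root _ _ _ #|X|); rewrite ?cardG_gt0 // -rmorphXn e1 rmorph1.
Qed.

Definition irr_degree_nat i : nat := Num.truncn ('chi_i 1%g).

Lemma irr_degree_natE i : 'chi_i 1%g = (irr_degree_nat i)%:R.
Proof. by rewrite truncnK // Cnat_irr1. Qed.

Lemma irr_degree_nat_gt0 i : (0 < irr_degree_nat i)%N.
Proof. by rewrite -(ltr_nat algC) -irr_degree_natE irr1_gt0. Qed.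

Lemma toK_irr1 i : toK ('chi_i 1%g) = (irr_degree_nat i)%:R.
Proof. by rewrite irr_degree_natE toK_nat. Qed.

Lemma toK_irr1_neq0 i : toK ('chi_i 1%g) != 0.
Proof. by rewrite toK_irr1 natK_eq0 -lt0n irr_degree_nat_gt0. Qed.

Lemma eval_gmul phi a c : in_galg X a -> in_galg X c ->
  eval phi (gmul a c) =
    \sum_(x in X) \sum_(y in X) tofrac (a x) * tofrac (c y) * toK (phi (x * y)%g).
Proof.
move=> Xa Xc; rewrite /cfun_eval.
under eq_bigr => g _ do rewrite gmulE rmorph_sum mulr_suml.
rewrite exchange_big /= [RHS]big_mkcond; apply: eq_bigr => x _ /=.
have [Xx | /Xa ax] := boolP (x \in X); last first.
  by rewrite big1 // => g _; rewrite ax mul0r rmorph0 mul0r.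
rewrite (reindex_inj (mulgI x)) /=.
apply: eq_big => [y|y _]; first by rewrite groupMl.
by rewrite mulKg rmorphM.
Qed.

(** Since [z] acts as a scalar on the module of [chi_i], the map
[z |-> chi_i(z)/chi_i(1)] is multiplicative on the centre; the identity is
useful also for non-central [c]. *)
Lemma eval_center_mul i z c : in_center X z -> in_galg X c ->
  eval 'chi_i (gmul z c) * toK ('chi_i 1%g) = eval 'chi_i z * eval 'chi_i c.
Proof.
move=> Zz Xc; have [Xz _] := Zz; rewrite eval_gmul //.
have X0 : #|X|%:R != 0 :> K by rewrite natK_eq0 -lt0n cardG_gt0.
apply: (mulfI X0); rewrite mulrA.
have -> : #|X|%:R * (\sum_(x in X) \sum_(y in X)
      tofrac (z x) * tofrac (c y) * toK ('chi_i (x * y)%g)) =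
    \sum_(x in X) \sum_(y in X) tofrac (z x) * tofrac (c y)
        * toK (\sum_(t in X) 'chi_i (x ^ t * y)%g).
  rewrite mulr_natl -sumr_const.
  transitivity (\sum_(t in X) \sum_(x in X) \sum_(y in X)
        tofrac (z x) * tofrac (c y) * toK ('chi_i (x ^ t * y)%g)).
    apply: eq_bigr => t Xt; rewrite (reindex_inj (conjg_inj t)) /=.
    apply: eq_big => [x|x Xx]; first by rewrite groupJr.
    by apply: eq_bigr => y _; rewrite (gcenter_conj x Zz).
  rewrite exchange_big; apply: eq_bigr => x Xx /=.
  rewrite exchange_big; apply: eq_bigr => y Xy /=.
  by rewrite toK_sum -?mulr_sumr // => t _; apply: irr_liftable.
rewrite !mulr_suml mulr_sumr; apply: eq_bigr => x Xx.
rewrite mulr_suml !mulr_sumr; apply: eq_bigr => y Xy.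
have cE := irr_liftable i.
rewrite irr_mul_class_sum // !toKM ?toKV ?toK_nat //;
  do ?[apply: liftableM | apply: liftableV | apply: liftable_nat] => //.
rewrite !mulrA divfK ?toK_irr1_neq0 //.
by rewrite [_ * #|X|%:R]mulrC !mulrA; congr (_ * _); rewrite mulrAC.
Qed.

Lemma evalB phi a b : eval phi (a - b) = eval phi a - eval phi b.
Proof.
rewrite /cfun_eval -sumrB; apply: eq_bigr => x _.
by rewrite !ffunE rmorphB mulrBl.
Qed.

Lemma evalD phi a b : eval phi (a + b) = eval phi a + eval phi b.
Proof.
rewrite /cfun_eval -big_split; apply: eq_bigr => x _.
by rewrite !ffunE rmorphD mulrDl.
Qed.

Lemma eval_scale phi k a : eval phi (gscale k a) = tofrac k * eval phi a.
Proof.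
rewrite /cfun_eval mulr_sumr; apply: eq_bigr => x _.
by rewrite !ffunE rmorphM mulrA.
Qed.

Lemma eval_one phi : eval phi (@galg_one O gT) = toK (phi 1%g).
Proof.
rewrite /cfun_eval (bigD1 1%g) //= ffunE eqxx rmorph1 mul1r big1 ?addr0 //.
by move=> x /andP[_ /negPf x1]; rewrite ffunE x1 rmorph0 mul0r.
Qed.

Lemma eval_inO i a : inO (eval 'chi_i a).
Proof.
apply: inO_sum => x _.
by apply: inOM; [apply: inO_tofrac | apply: irr_inO].
Qed.

Definition central_char i z : K := eval 'chi_i z / toK ('chi_i 1%g).
Local Notation omega := central_char.

Lemma omegaE i z : eval 'chi_i z = toK ('chi_i 1%g) * omega i z.
Proof. by rewrite mulrC divfK ?toK_irr1_neq0. Qed.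

Lemma omegaM i z y : in_center X z -> in_center X y ->
  omega i (gmul z y) = omega i z * omega i y.
Proof.
move=> Zz Zy; have := eval_center_mul i Zz (proj1 Zy).
have d0 := toK_irr1_neq0 i; rewrite !omegaE => eval_zy.
apply: (mulfI d0); apply: (mulfI d0).
by rewrite mulrC eval_zy -mulrA; congr (_ * _); rewrite mulrCA.
Qed.
End Evaluation.

(** * Central characters *)

Section CentralCharacters.
Variables (p : nat) (M : modular_system p) (gT : finGroupType) (X : {group gT}).
Hypothesis rX : has_roots_of_unity M #|X|.
Local Notation O := (ms_O M).
Local Notation K := {fraction (ms_O M)}.
Local Notation toK := (toK M).
Local Notation eval := (@cfun_eval p M gT X).
Local Notation omega := (@central_char p M gT X).
Implicit Types (i j : Iirr X) (phi psi : 'CF(X)) (a b c z y : {ffun gT -> O}).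
Implicit Types (D P : {group gT}).

Lemma card_group_neq0 D : #|D|%:R != 0 :> K.
Proof. by rewrite natK_eq0 -lt0n cardG_gt0. Qed.

Lemma omegaD i z y : omega i (z + y) = omega i z + omega i y.
Proof. by rewrite /central_char evalD mulrDl. Qed.

Lemma omegaB i z y : omega i (z - y) = omega i z - omega i y.
Proof. by rewrite /central_char evalB mulrBl. Qed.

Lemma omega_scale i k z : omega i (gscale k z) = tofrac k * omega i z.
Proof. by rewrite /central_char eval_scale mulrA. Qed.

Lemma omega_one i : omega i (galg_one O gT) = 1.
Proof. by rewrite /central_char eval_one divff ?toK_irr1_neq0. Qed.

Lemma omega0 i : omega i 0 = 0.
Proof. by rewrite -(subrr (0 : {ffun gT -> O})) omegaB subrr. Qed.

Lemma omega_iter i z n : in_center X z ->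
  in_center X (iter n (gmul z) (galg_one O gT)) /\
  omega i (iter n (gmul z) (galg_one O gT)) = omega i z ^+ n.
Proof.
move=> Zz; elim: n => [|n [Zw omw]] /=.
  by rewrite omega_one; split; first exact: gcenter1.
by split; [apply: gcenterM | rewrite omegaM // omw exprS].
Qed.

(** The powers of [omega i z] have a bounded denominator, since multiplying
them by [chi_i(1)] gives the value of [chi_i] at a power of [z]. *)
Lemma omega_inO i z : in_center X z -> inO (omega i z).
Proof.
move=> Zz; apply: (@inO_bounded _ _ _ (toK ('chi_i 1%g))) => [|n].
  exact: toK_irr1_neq0.
have [_ <-] := omega_iter i n Zz.
by rewrite -omegaE; apply: eval_inO.
Qed.

Lemma omega_idem i z : central_idem X z -> omega i z = 0 \/ omega i z = 1.
Proof.
case=> Zz zz; have := omegaM rX i Zz Zz; rewrite zz => /eqP.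
rewrite -subr_eq0 -{1}[omega i z]mulr1 -mulrBr mulf_eq0 => /orP[/eqP->|]; first by left.
by rewrite subr_eq0 eq_sym => /eqP ->; right.
Qed.

Lemma eval_idem i z : central_idem X z -> eval 'chi_i z != 0 ->
  eval 'chi_i z = toK ('chi_i 1%g).
Proof.
move=> Iz; rewrite omegaE; case: (omega_idem i Iz) => ->; rewrite ?mulr1 //.
by rewrite mulr0 eqxx.
Qed.

(** Second orthogonality relation, in the form of an inversion formula. *)
Lemma center_inversion z g : in_center X z -> g \in X ->
  tofrac (z g) * #|X|%:R = \sum_i eval 'chi_i z * toK ('chi_i g^-1%g).
Proof.
move=> Zz Xg; rewrite /cfun_eval.
under eq_bigr => i _ do rewrite mulr_suml.
rewrite exchange_big /=.
have -> : \sum_(x in X) \sum_i tofrac (z x) * toK ('chi[X]_i x) * toK ('chi_i g^-1%g)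
    = \sum_(x in X | x \in (g ^: X)%g) tofrac (z g) * #|'C_X[g]%g|%:R.
  rewrite big_mkcondr; apply: eq_bigr => x Xx.
  rewrite (eq_bigr (fun i => tofrac (z x) * toK ('chi_i x * ('chi_i g)^*)))
    => [|i _]; last first.
    by rewrite -irr_inv toKM ?mulrA //; apply: irr_liftable.
  rewrite -mulr_sumr -toK_sum => [|i _]; last first.
    by rewrite -irr_inv; apply: liftableM; apply: irr_liftable.
  rewrite second_orthogonality_relation //.
  case: ifP => xg; last by rewrite mulr0n (toK_nat M 0) mulr0.
  have [t Xt ->] := imsetP xg; rewrite mulr1n toK_nat (gcenter_conj g Zz) //.
  by rewrite cent1J -{1}(conjGid Xt) -conjIg cardJg.
rewrite (eq_bigl (mem (g ^: X)%g)) => [|x]; last first.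
  by rewrite andb_idl // => /imsetP[t Xt ->]; rewrite groupJ.
rewrite sumr_const -[RHS]mulr_natr -mulrA -natrM -index_cent1.
by rewrite Lagrange ?subsetIl.
Qed.

Lemma center_eq_eval z y : in_center X z -> in_center X y ->
  (forall i, eval 'chi_i z = eval 'chi_i y) -> z = y.
Proof.
move=> Zz Zy zy; apply/ffunP=> g; have [Xg | X'g] := boolP (g \in X); last first.
  by rewrite (proj1 Zz) ?(proj1 Zy).
apply/eqP; rewrite -tofrac_eq; apply/eqP; apply: (mulIf (card_group_neq0 X)).
by rewrite !center_inversion //; apply: eq_bigr => i _; rewrite zy.
Qed.

Lemma mulnO_inj D : injective (fun u : O => #|D|%:R * u).
Proof.
move=> u v /(congr1 (@tofrac O)); rewrite !rmorphM rmorph_nat.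
by move/(mulfI (card_group_neq0 D))/eqP; rewrite tofrac_eq => /eqP.
Qed.

Lemma rel_trace_center D a : D \subset X -> in_galg X a -> fixed_by D a ->
  in_center X (rel_trace D X a).
Proof.
move=> sDX Xa aD; apply: conj_gcenter => [g X'g|g t Xt]; apply: (@mulnO_inj D).
  rewrite mulr0 rel_trace_sum // big1 // => t Xt.
  by rewrite Xa // memJ_norm // (subsetP (normG X)).
rewrite !rel_trace_sum // [RHS](reindex_inj (mulgI t)) /=.
by apply: eq_big => [s|s _]; rewrite ?groupMl // conjgM.
Qed.

Lemma eval_rel_trace phi D a : D \subset X -> fixed_by D a ->
  eval phi (rel_trace D X a) = #|X : D|%g%:R * eval phi a.
Proof.
move=> sDX aD; apply: (mulfI (card_group_neq0 D)).
rewrite mulrA -natrM Lagrange // [RHS]mulr_natl -[RHS]sumr_const.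
transitivity (\sum_(t in X) \sum_(g in X) tofrac (a (g ^ t)%g) * toK (phi g)).
  rewrite exchange_big /= mulr_sumr; apply: eq_bigr => g Xg.
  rewrite mulrA -(rmorph_nat (@tofrac O)) -rmorphM rel_trace_sum //.
  by rewrite rmorph_sum mulr_suml.
apply: eq_bigr => t Xt; rewrite /cfun_eval [RHS](reindex_inj (conjg_inj t)) /=.
by apply: eq_big => [g|g Xg]; rewrite ?groupJr // cfunJ.
Qed.

Lemma fixed_gmul D z a : fixed_by D z -> fixed_by D a -> fixed_by D (gmul z a).
Proof. by move=> zD aD t g Dt; apply: gmul_conj => x; [apply: zD | apply: aD]. Qed.

Lemma gcenter_fixed D z : in_center X z -> D \subset X -> fixed_by D z.
Proof. by move=> Zz sDX t g Dt; rewrite (gcenter_conj g Zz) // (subsetP sDX). Qed.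

Lemma rel_trace_gmul D a y : D \subset X -> fixed_by D a -> in_center X y ->
  gmul (rel_trace D X a) y = rel_trace D X (gmul a y).
Proof.
move=> sDX aD Zy; apply/ffunP=> g; apply: (@mulnO_inj D).
rewrite rel_trace_sum //; last by apply/fixed_gmul/(gcenter_fixed Zy).
rewrite gmulE mulr_sumr.
under eq_bigr => x _ do rewrite mulrA rel_trace_sum // mulr_suml.
rewrite exchange_big /=; apply: eq_bigr => t Xt.
rewrite gmulE [RHS](reindex_inj (conjg_inj t)) /=; apply: eq_bigr => x _.
by rewrite -conjVg -conjMg (gcenter_conj _ Zy).
Qed.

End CentralCharacters.

(** * Restriction and induction *)

Section Restriction.
Variables (p : nat) (M : modular_system p) (gT : finGroupType) (X L : {group gT}).
Hypotheses (rX : has_roots_of_unity M #|X|) (sLX : L \subset X).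
Local Notation O := (ms_O M).
Local Notation K := {fraction (ms_O M)}.

Lemma eval_res (phi : 'CF(X)) (a : {ffun gT -> O}) : in_galg L a ->
  cfun_eval ('Res[L] phi) a = cfun_eval phi a.
Proof.
move=> La; rewrite /cfun_eval [RHS](big_setID L) /= [X in _ + X]big1 ?addr0 => [|g].
  by rewrite (setIidPr sLX); apply: eq_bigr => g Lg; rewrite cfResE.
by case/setDP=> _ /La ->; rewrite rmorph0 mul0r.
Qed.

Lemma ind_liftable (phi : 'CF(L)) : (forall x, liftable M (phi x)) ->
  forall x, liftable M ('Ind[X] phi x).
Proof.
move=> phiE x; rewrite cfIndE //; apply: liftableM.
  by apply/liftableV/liftable_nat.
by apply: liftable_sum.
Qed.

Lemma eval_ind (phi : 'CF(L)) (z : {ffun gT -> O}) :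
    (forall x, liftable M (phi x)) -> in_center X z ->
  cfun_eval ('Ind[X] phi) z = #|X : L|%g%:R * cfun_eval phi z.
Proof.
move=> phiE Zz; apply: (mulfI (card_group_neq0 M L)).
rewrite [RHS]mulrA -natrM Lagrange // [RHS]mulr_natl -[RHS]sumr_const mulr_sumr.
transitivity (\sum_(g in X) \sum_(t in X) tofrac (z g) * toK M (phi (g ^ t)%g)).
  apply: eq_bigr => g Xg; rewrite cfIndE // toKM; last 2 first.
  - by apply/liftableV/liftable_nat.
  - by apply: liftable_sum.
  rewrite toKV ?toK_nat; last exact: liftable_nat.
  by rewrite mulrCA mulVKf ?card_group_neq0 // toK_sum // mulr_sumr.
rewrite exchange_big; apply: eq_bigr => t Xt /=.
rewrite (reindex_inj (conjg_inj t^-1)%g) /= (eq_bigl (mem X)) => [|g]; last first.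
  by rewrite groupJr ?groupV.
rewrite (big_setID L) /= [X in _ + X]big1 ?addr0 => [|g].
  rewrite (setIidPr sLX); apply: eq_bigr => g Lg.
  by rewrite conjgKV (gcenter_conj g Zz) ?groupV.
by case/setDP=> _ L'g; rewrite conjgKV cfun0 // (toK_nat M 0) mulr0.
Qed.

End Restriction.

(** * Characters of a block and the Brauer morphism *)

Section HeightZero.
Variables (p : nat) (M : modular_system p) (gT : finGroupType) (X P : {group gT}).
Hypotheses (rX : has_roots_of_unity M #|X|) (sPX : P \subset X) (pP : (p.-group P)%g).
Local Notation O := (ms_O M).
Local Notation K := {fraction (ms_O M)}.
Local Notation red := (ms_red M).
Local Notation eval := (@cfun_eval p M gT X).
Implicit Types (i : Iirr X) (a z f : {ffun gT -> O}).

Lemma conj_sum_fix (h : gT -> ms_k M) :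
    (forall g t, t \in P -> h (g ^ t)%g = h g) ->
  \sum_(g in X) h g = \sum_(g in 'C_X(P)%g) h g.
Proof.
move=> hP; rewrite (@pgroup_sum_fix _ p _ _ _ 'J%act P) ?(ms_charp M) ?afixJ //.
  by rewrite astabsJ (subset_trans sPX) ?normG.
by move=> g t _ Pt; apply: hP.
Qed.

(** This is the multiplicativity of the Brauer morphism on elements fixed by
[P], in the case needed here: [P] permutes the terms of the convolution, and
only those indexed by [C_X(P)] survive modulo [p]. *)
Lemma red_gmul_center_eq0 z a g : in_center X z -> in_galg X a -> fixed_by P a ->
  (forall x, x \in 'C_X(P)%g -> red (z x) = 0) -> g \in 'C_X(P)%g ->
  red (gmul z a g) = 0.
Proof.
move=> Zz Xa aP z0 /setIP[Xg cPg].
rewrite gmulE (bigID (mem X)) /= [X in _ + X]big1 ?addr0 => [|x /(proj1 Zz) ->];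
  last first.
  by rewrite mul0r.
rewrite rmorph_sum (conj_sum_fix (h := fun x => red (z x * a (x^-1 * g)%g))) => [|x t Pt].
  by rewrite big1 // => x Cx; rewrite rmorphM z0 ?mul0r.
rewrite (gcenter_conj _ Zz) ?(subsetP sPX) // -(aP t (x^-1 * g)%g) // conjMg conjVg.
by rewrite [(g ^ t)%g]conjgE (centP cPg) // mulKg.
Qed.

Lemma in_max_eval i c : fixed_by P c ->
  (forall x, x \in 'C_X(P)%g -> red (c x) = 0) -> in_max (eval 'chi_i c).
Proof.
move=> cP c0.
have [h hE] := fin_all_exists (irr_inO rX i).
have -> : eval 'chi_i c = tofrac (\sum_(g in X) c g * h g).
  by rewrite rmorph_sum; apply: eq_bigr => g _; rewrite hE rmorphM.
apply/in_max_tofrac; rewrite rmorph_sum (conj_sum_fix (h := fun g => red (c g * h g))).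
  by rewrite big1 // => x Cx; rewrite rmorphM c0 ?mul0r.
move=> g t Pt; have Xt := subsetP sPX t Pt; rewrite cP //; congr (red (_ * _)).
by apply/eqP; rewrite -tofrac_eq -!hE cfunJ.
Qed.

(** Let [f] be the trace of [a] from [P].  As [chi_i(f) = chi_i(1)], the value
[chi_i(z)] is [|X:P|] times [chi_i(za)], and [za] is fixed by [P] with image
[0] under the Brauer morphism. *)
Lemma in_max_eval_center i f z : central_idem X f -> rel_projective X f P ->
    eval 'chi_i f != 0 -> in_center X z ->
    (forall x, x \in 'C_X(P)%g -> red (z x) = 0) ->
  in_max (eval 'chi_i z / #|X : P|%g%:R).
Proof.
move=> If [_ [a [Xa aP fE]]] fi Zz z0.
have XP0 : #|X : P|%g%:R != 0 :> K by rewrite natK_eq0 -lt0n indexg_gt0.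
have f1 := eval_idem rX If fi.
have fa : eval 'chi_i f = #|X : P|%g%:R * eval 'chi_i a by rewrite fE eval_rel_trace.
have a0 : eval 'chi_i a != 0 by apply: contraNneq fi => a0; rewrite fa a0 mulr0.
suff -> : eval 'chi_i z / #|X : P|%g%:R = eval 'chi_i (gmul z a).
  apply: in_max_eval; first exact: fixed_gmul (gcenter_fixed Zz sPX) aP.
  by move=> x; apply: red_gmul_center_eq0.
apply: (mulIf a0); rewrite mulrAC -(eval_center_mul rX i Zz Xa) -f1 fa.
by rewrite mulrCA mulrAC mulfV // mul1r.
Qed.

End HeightZero.

(** * Relative traces modulo the maximal ideal *)

Section TraceFix.
Variables (p : nat) (M : modular_system p) (gT : finGroupType).
Local Notation O := (ms_O M).
Local Notation red := (ms_red M).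
Implicit Types (a b : {ffun gT -> O}) (X D Q P G H : {group gT}).

Lemma fixed_repr_rcoset D a g x : fixed_by D a ->
  a (g ^ (repr (D :* x)%g)^-1)%g = a (g ^ x^-1)%g.
Proof.
move=> aD; have /rcosetP[d Dd ->] : repr (D :* x)%g \in (D :* x)%g.
  exact: mem_repr (rcoset_refl _ _).
by rewrite invMg conjgM aD ?groupV.
Qed.

Lemma red_rel_trace_fix D X Q a g :
    D \subset X -> fixed_by D a -> (p.-group Q)%g -> (Q \subset 'C_X[g])%g ->
  red (rel_trace D X a g)
    = \sum_(C in ('Fix_(rcosets D X | 'Rs)(Q))%g) red (a (g ^ (repr C)^-1)%g).
Proof.
move=> sDX aD pQ; rewrite subsetI => /andP[sQX cQg].
rewrite rel_trace_rcosets // rmorph_sum.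
rewrite (@pgroup_sum_fix _ p _ _ _ 'Rs%act Q) ?(ms_charp M) //.
  exact: subset_trans sQX (actsRs_rcosets _ _).
move=> C q /rcosetsP[x Xx ->] Qq /=.
rewrite rcosetE -rcosetM !fixed_repr_rcoset // invMg conjgM; congr (red (a (_ ^ _)%g)).
by apply/conjg_fixP/commgP/commuteV/commute_sym/cent1P; apply: (subsetP cQg).
Qed.

(** If no coset of [D] were fixed by [Q], the trace would vanish at [g]
modulo [p]. *)
Lemma rel_projective_cent D X Q b g : rel_projective X b D ->
    (p.-group Q)%g -> (Q \subset 'C_X[g])%g -> red (b g) <> 0 ->
  exists2 x, x \in X & (Q \subset D :^ x)%g.
Proof.
move=> [sDX [a [_ aD ->]]] pQ cQ; rewrite (red_rel_trace_fix sDX aD pQ cQ) => nz.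
have [C] : exists C, C \in ('Fix_(rcosets D X | 'Rs)(Q))%g.
  by apply/set0Pn; apply: contra_notN nz => /eqP ->; rewrite big_set0.
case/setIP=> /rcosetsP[x Xx ->] /afixP Qx; exists x => //; apply/subsetP=> q Qq.
have : (x * q)%g \in (D :* x)%g.
  by have /= := Qx q Qq; rewrite rcosetE -rcosetM => <-; apply: rcoset_refl.
by rewrite mem_rcoset mem_conjg conjgE invgK mulgA.
Qed.

(** Both traces are sums over the cosets fixed by [P], and these are the cosets
of [P] in its normalizer, which lies in [H]. *)
Lemma red_rel_trace_norm G H P a g :
    P \subset H -> H \subset G -> ('N_G(P) \subset H)%g -> fixed_by P a ->
    (p.-group P)%g -> g \in ('C_G(P))%g ->
  red (rel_trace P G a g) = red (rel_trace P H a g).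
Proof.
move=> sPH sHG sNH aP pP /setIP[Gg cPg]; have sPG := subset_trans sPH sHG.
have Hg : g \in H by rewrite (subsetP sNH) // inE Gg (subsetP (cent_sub P)).
have cP X : P \subset X -> (P \subset 'C_X[g])%g by rewrite subsetI sub_cent1 cPg andbT.
rewrite !(red_rel_trace_fix _ aP pP) ?cP // !afixRs_rcosets.
suff -> : ('N_H(P) = 'N_G(P))%g by [].
by apply/eqP; rewrite eqEsubset setSI //= subsetI sNH subsetIr.
Qed.

End TraceFix.

(** * Negligible class functions *)

Section Congruence.
Variables (p : nat) (M : modular_system p) (gT : finGroupType) (X P : {group gT}).
Hypotheses (rX : has_roots_of_unity M #|X|) (sPX : P \subset X) (pP : (p.-group P)%g).
Local Notation O := (ms_O M).
Local Notation K := {fraction (ms_O M)}.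
Local Notation eval := (@cfun_eval p M gT X).
Implicit Types (i : Iirr X) (phi psi : 'CF(X)) (a b z f : {ffun gT -> O}).

Lemma degE i : deg 'chi_i = (irr_degree_nat i)%:Z.
Proof. by rewrite /deg irr_degree_natE -[_%:R]/((Posz _)%:~R) Num.Theory.intrKfloor. Qed.

Lemma vp_deg i : vp p (deg 'chi_i) = logn p (irr_degree_nat i).
Proof. by rewrite degE. Qed.

Lemma index_neq0 : #|X : P|%g%:R != 0 :> K.
Proof. by rewrite natK_eq0 -lt0n indexg_gt0. Qed.

(** If the block of [chi_i] is the trace of [a] from a subgroup [D] of [P] then
[chi_i(1) = |X:D| chi_i(a)]. *)
Lemma IrrP_degree i : i \in IrrP M X P ->
  inO ((irr_degree_nat i)%:R / #|X : P|%g%:R : K).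
Proof.
rewrite inE => /boolp.asboolP[b [[Ib _ _] [D [[sDX [a [_ aD bE]]] _] sDP]]].
rewrite inE => bi; rewrite -toK_irr1 -(eval_idem rX Ib bi) bE eval_rel_trace //.
rewrite -(Lagrange_index sPX sDP) natrM -[_ * _ * eval _ _]mulrA mulrAC.
rewrite mulfV ?index_neq0 // mul1r.
by apply: inOM; [apply: inO_nat | apply: eval_inO].
Qed.

Lemma IrrpP_degree i : i \in IrrpP M X P ->
  in_max ((irr_degree_nat i)%:R / #|X : P|%g%:R : K).
Proof.
case/setDP=> Pi; rewrite /Irr0P in_set Pi /= vp_deg => neq.
apply: in_max_ratio_of_inO neq; rewrite ?irr_degree_nat_gt0 ?indexg_gt0 //.
exact: IrrP_degree.
Qed.

Lemma Irr0P_degree i : i \in Irr0P M X P ->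
  ~ in_max ((irr_degree_nat i)%:R / #|X : P|%g%:R : K).
Proof.
case/setIdP=> _; rewrite vp_deg => /eqP eqv.
by apply: not_in_max_ratio; rewrite ?irr_degree_nat_gt0 ?indexg_gt0.
Qed.

(** Congruences between character values are read modulo the ideal [|X:P| m];
liftability makes evaluation additive. *)
Definition negligible z phi : Prop :=
  (forall x, liftable M (phi x)) /\ in_max (eval phi z / #|X : P|%g%:R).

Lemma eval_cfunD phi psi z :
    (forall x, liftable M (phi x)) -> (forall x, liftable M (psi x)) ->
  eval (phi + psi) z = eval phi z + eval psi z.
Proof.
move=> phiE psiE; rewrite /cfun_eval -big_split; apply: eq_bigr => x _.
by rewrite cfunE toKD // mulrDr.
Qed.

Lemma eval_cfunN phi z : (forall x, liftable M (phi x)) -> eval (- phi) z = - eval phi z.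
Proof.
move=> phiE; rewrite /cfun_eval -sumrN; apply: eq_bigr => x _.
by rewrite cfunE toKN // mulrN.
Qed.

Lemma eval_cfun0 z : eval 0 z = 0.
Proof. by rewrite /cfun_eval big1 // => x _; rewrite cfunE (toK_nat M 0) mulr0. Qed.

Lemma negligible0 z : negligible z 0.
Proof.
split; first by move=> x; rewrite cfunE; apply: (liftable_nat M 0).
by rewrite eval_cfun0 mul0r; apply: in_max0.
Qed.

Lemma negligibleD z phi psi :
  negligible z phi -> negligible z psi -> negligible z (phi + psi).
Proof.
move=> [phiE sphi] [psiE spsi]; split; first by move=> x; rewrite cfunE; apply: liftableD.
by rewrite eval_cfunD // mulrDl; apply: in_maxD.
Qed.

Lemma negligibleN z phi : negligible z phi -> negligible z (- phi).
Proof.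
move=> [phiE sphi]; split; first by move=> x; rewrite cfunE; apply: liftableN.
by rewrite eval_cfunN // mulNr; apply: in_maxN.
Qed.

Lemma negligibleMz z phi n : negligible z phi -> negligible z (phi *~ n).
Proof.
move=> zphi; have zn k : negligible z (phi *+ k).
  elim: k => [|k IHk]; first exact: negligible0.
  by rewrite mulrS; apply: negligibleD.
by case: n => k; [apply: zn | rewrite NegzE mulrNz; apply/negligibleN/zn].
Qed.

Lemma negligible_sum z (I : Type) (r : seq I) (F : I -> 'CF(X)) :
  (forall k, negligible z (F k)) -> negligible z (\sum_(k <- r) F k).
Proof.
move=> Fz; elim/big_rec: _ => [|k phi _ zphi]; first exact: negligible0.
exact: negligibleD.
Qed.

Lemma CpP_negligible z phi : in_center X z -> phi \in CpP M X P -> negligible z phi.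
Proof.
move=> Zz /zchar_nth_expansion[c Zc ->]; apply: negligible_sum => k.
have /intrP[m ->] := Zc k; rewrite scaler_int; apply: negligibleMz.
have /mapP[i] : (([seq 'chi_i | i in IrrpP M X P]) : seq 'CF(X))`_k
    \in [seq 'chi_i | i in IrrpP M X P].
  exact: mem_nth.
rewrite mem_enum => pi ->; split; first by move=> x; apply: irr_liftable.
rewrite omegaE toK_irr1 mulrAC; apply: in_maxMr; last exact: omega_inO.
exact: IrrpP_degree.
Qed.

Lemma roots_subgroup (L : {group gT}) : L \subset X -> has_roots_of_unity M #|L|.
Proof.
move=> sLX; have [w prim_w] := rX; exists (w ^+ (#|X| %/ #|L|)).
exact/dvdn_prim_root/cardSg.
Qed.

Lemma vchar_value (L : {group gT}) (phi : 'CF(L)) x : L \subset X ->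
  phi \in 'Z[irr L]%g -> liftable M (phi x) /\ inO (toK M (phi x)).
Proof.
move=> sLX /zchar_tuple_expansion[c Zc ->]; rewrite sum_cfunE.
have cE k : exists2 m : int, c k = m%:~R & exists i : Iirr L, (irr L)`_k = 'chi_i.
  have /intrP[m ->] := Zc k; exists m => //.
  by exists k; rewrite -tnth_nth.
have lift_k k : liftable M ((c k *: (irr L)`_k) x).
  have [m -> [i ->]] := cE k; rewrite cfunE; apply: liftableM.
    by exists m%:~R; rewrite rmorph_int.
  exact: irr_liftable (roots_subgroup sLX) _ _.
split; first exact: liftable_sum.
rewrite toK_sum //; apply: inO_sum => k _; have [m -> [i ->]] := cE k.
rewrite cfunE toKM; last 2 first.
- by exists m%:~R; rewrite rmorph_int.
- exact: irr_liftable (roots_subgroup sLX) _ _.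
by rewrite toK_int; apply: inOM; [apply: inO_int | apply/irr_inO/roots_subgroup].
Qed.

Lemma IXPS_negligible (S : {set {group gT}}) z phi :
  in_center X z -> P \notin S -> IXPS p X P S phi -> negligible z phi.
Proof.
move=> Zz S'P [n [c [g [Sg ->]]]]; apply: negligible_sum => k; apply: negligibleMz.
have [L [theta [sLX sylLP SLP Ztheta ->]]] := Sg k.
have thetaE x : liftable M (theta x) by case: (vchar_value x sLX Ztheta).
split; first exact: ind_liftable.
rewrite eval_ind // mulrAC; apply: in_maxMr; last first.
  apply: inO_sum => x _; apply: inOM; first exact: inO_tofrac.
  by case: (vchar_value x sLX Ztheta).
have -> : #|X : L|%g%:R / #|X : P|%g%:R = #|P|%:R / #|L|%:R :> K.
  apply/eqP; rewrite eqr_div ?index_neq0 ?card_group_neq0 //.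
    by rewrite -!natrM mulnC !Lagrange.
apply: in_max_ratio; rewrite ?cardG_gt0 //.
have ltLP : (#|L :&: P| < #|P|)%N.
  apply: proper_card; rewrite properEneq subsetIr andbT.
  by apply: contraNneq S'P => LP; rewrite -(group_inj LP).
have pLP : (p.-group (L :&: P))%g by apply: pgroupS (subsetIr _ _) pP.
rewrite -logn_part -(card_Hall sylLP).
have p_gt1 := prime_gt1 (ms_prime M).
have := ltLP; rewrite {1}(card_pgroup pLP) (card_pgroup pP).
by rewrite ltn_exp2l // pfactorK ?(ms_prime M).
Qed.

End Congruence.

(** * Comparison of the defect groups of a block *)

Section DefectGroups.
Variables (p : nat) (M : modular_system p) (gT : finGroupType) (X : {group gT}).
Hypothesis rX : has_roots_of_unity M #|X|.
Local Notation O := (ms_O M).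
Local Notation K := {fraction (ms_O M)}.
Local Notation red := (ms_red M).
Local Notation toK := (toK M).
Local Notation eval := (@cfun_eval p M gT X).
Local Notation omega := (@central_char p M gT X).
Implicit Types (i j : Iirr X) (a b z y : {ffun gT -> O}) (P Q D : {group gT}).

Lemma center_eq_omega z y : in_center X z -> in_center X y ->
  (forall i, omega i z = omega i y) -> z = y.
Proof. by move=> Zz Zy zy; apply: (center_eq_eval rX) => // i; rewrite !omegaE zy. Qed.

(** Characters are added to [T] one at a time: if [zy] has value [1] on the
previous ones, adding to [y] the element [u (1 - zy)], with
[u = omega_j(z)^-1], keeps these values and produces the value [1] at the new
character [j]. *)
Lemma center_invert_on (T : seq (Iirr X)) z : in_center X z ->
    (forall i, i \in T -> ~ in_max (omega i z)) ->
  exists2 y, in_center X y & forall i, i \in T -> omega i (gmul z y) = 1.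
Proof.
move=> Zz; elim: T => [|j T IHT] Tz; first by exists z.
have [|y Zy zy] := IHT; first by move=> i Ti; apply: Tz; rewrite inE Ti orbT.
have zj : ~ in_max (omega j z) by apply: Tz; rewrite inE eqxx.
have [u uE] := inOV (omega_inO rX j Zz) zj.
have zj0 : omega j z != 0 by apply: contra_notN zj => /eqP ->; apply: in_max0.
have Zzy := gcenterM Zz Zy.
have Zr : in_center X (galg_one O gT - gmul z y).
  by apply: gcenterB => //; apply: gcenter1.
exists (y + gscale u (galg_one O gT - gmul z y)).
  by apply: gcenterD => //; apply: gcenterZ.
move=> i; rewrite omegaM //; last by apply: gcenterD => //; apply: gcenterZ.
rewrite omegaD omega_scale omegaB omega_one mulrDr -omegaM //.
rewrite inE => /orP[/eqP -> | Ti]; last by rewrite zy // subrr !mulr0 addr0.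
by rewrite -uE mulrA divff // mul1r addrCA subrr addr0.
Qed.

(** The centre of a block algebra is local.  Let [S] be the set of characters
of [b] whose central character at [z] is a unit.  The previous lemma gives [w],
a multiple of [z] lying in the block, with central character [1] on [S] and in
the maximal ideal elsewhere.  Its powers tend to the idempotent of [S], which
therefore has integral coefficients; as [b] is primitive this idempotent is
[b], hence [w = b]. *)
Lemma block_local b z i : is_block X b -> in_center X z ->
    eval 'chi_i b != 0 -> ~ in_max (omega i z) ->
  exists2 y, in_center X y & gmul z y = b.
Proof.
move=> [Ib b0 prim_b] Zz bi zi; have [Zb bb] := Ib.
have X0 : #|X|%:R != 0 :> K := card_group_neq0 M X.
have omb j : omega j b = (eval 'chi_j b != 0)%:R.
  case: eqP => [bj|/eqP bj]; first by rewrite /central_char bj mul0r.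
  by rewrite /central_char (eval_idem rX Ib) // divff ?toK_irr1_neq0.
pose S j := (eval 'chi_j b != 0) && ~~ boolp.asbool (in_max (omega j z)).
have [y0 Zy0 y0E] : exists2 y, in_center X y &
    forall j, j \in enum S -> omega j (gmul z y) = 1.
  by apply: center_invert_on => // j; rewrite mem_enum => /andP[_ /boolp.asboolP].
pose y := gmul y0 b; have Zy : in_center X y by apply: gcenterM.
pose w := gmul z y; have Zw : in_center X w by apply: gcenterM.
have omw j : omega j w = omega j z * omega j y0 * omega j b.
  by rewrite !omegaM // mulrA.
have w1 j : S j -> omega j w = 1.
  move=> Sj; rewrite omw -omegaM // y0E ?mem_enum // omb.
  by case/andP: Sj => -> _; rewrite mul1r.
have w_max j : ~~ S j -> in_max (omega j w).
  rewrite /S omw omb; case: eqP => [_ _|_ /= /negPn/boolp.asboolP zj].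
    by rewrite mulr0; apply: in_max0.
  by rewrite mulr1; apply: in_maxMr => //; apply: omega_inO.
(* [|X|] is a common denominator of the idempotents of single characters, so
   the power [N.+1] brings the contribution outside [S] into [O X]. *)
have [N wN] : exists N, forall j, ~~ S j -> inO (omega j w ^+ N.+1 / #|X|%:R).
  have /fin_all_exists[n nE] j : exists n, ~~ S j -> inO (omega j w ^+ n.+1 / #|X|%:R).
    have [Sj|/w_max wj] := boolP (S j); first by exists 0%N.
    by have [n nE] := in_maxX_div wj X0; exists n.
  exists (\max_j n j)%N => j S'j; have le_nN : (n j <= \max_j n j)%N by apply: leq_bigmax.
  rewrite -(subnK le_nN) -addnS exprD -mulrA; apply: inOM (nE j S'j).
  by apply/inOX/in_max_inO/w_max.
(* The coefficients over [K] of the sum of the idempotents of the characters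
   in [S]. *)
pose q g : K := #|X|%:R^-1 * \sum_(j | S j) toK ('chi_j 1%g) * toK ('chi_j g^-1%g).
have Oq g : inO (q g).
  have [Xg | X'g] := boolP (g \in X); last first.
    rewrite /q big1 ?mulr0 => [|j _]; first by exists 0; rewrite rmorph0.
    by rewrite [_ g^-1%g]cfun0 ?groupV // (toK_nat M 0) mulr0.
  have [Zwn _] := omega_iter rX i N.+1 Zw.
  have := center_inversion rX Zwn Xg; rewrite (bigID S) /=.
  move/(canRL (mulfK X0)) => wg.
  have -> : q g = tofrac (iter N.+1 (gmul w) (galg_one O gT) g) - 
    \sum_(j | ~~ S j) (omega j w ^+ N.+1 / #|X|%:R)
                      * (toK ('chi_j 1%g) * toK ('chi_j g^-1%g)).
    rewrite wg mulrDl -addrA.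
    rewrite [X in _ + X](_ : _ = 0) ?addr0 => [|].
      rewrite /q mulr_sumr mulr_suml; apply: eq_bigr => j Sj.
      rewrite omegaE; have [_ ->] := omega_iter rX j N.+1 Zw.
      by rewrite w1 // expr1n mulr1 mulrC.
    apply/eqP; rewrite subr_eq0 mulr_suml; apply/eqP; apply: eq_bigr => j _.
    rewrite omegaE; have [_ ->] := omega_iter rX j N.+1 Zw.
    by rewrite [RHS]mulrAC -[toK _ * _ * _]mulrA [toK _ * (_ * _)]mulrCA.
  apply: inOB; first exact: inO_tofrac.
  apply: inO_sum => j /wN wj; apply: inOM => //; apply: inOM; exact: irr_inO.
have [u uE] := fin_all_exists Oq.
pose eps : {ffun gT -> O} := [ffun g => u g].
have epsE g : tofrac (eps g) = q g by rewrite ffunE uE.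
have Zeps : in_center X eps.
  apply: conj_gcenter => [g X'g | g t Xt]; apply/eqP; rewrite -tofrac_eq !epsE.
    rewrite rmorph0 /q big1 ?mulr0 // => j _.
    by rewrite [_ g^-1%g]cfun0 ?groupV // (toK_nat M 0) mulr0.
  by rewrite /q; apply/eqP; congr (_ * _); apply: eq_bigr => j _; rewrite -conjVg cfunJ.
have omeps j : omega j eps = (S j)%:R.
  have cE k g := irr_liftable rX k g.
  rewrite /central_char /cfun_eval.
  have -> : \sum_(g in X) tofrac (eps g) * toK ('chi_j g)
      = \sum_(k | S k) toK ('chi_k 1%g)
          * toK (#|X|%:R^-1 * \sum_(g in X) 'chi_j g * 'chi_k g^-1%g).
    under eq_bigr => g Xg do rewrite epsE /q mulr_sumr mulr_suml.
    rewrite exchange_big; apply: eq_bigr => k Sk /=.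
    have cc g : liftable M ('chi_j g * 'chi_k g^-1%g) by apply: liftableM.
    rewrite toKM; [|by apply/liftableV/liftable_nat|by apply: liftable_sum].
    rewrite toKV ?toK_nat; last exact: liftable_nat.
    rewrite toK_sum // !mulr_sumr; apply: eq_bigr => g Xg.
    rewrite toKM //; rewrite mulrCA -!mulrA; congr (_ * (_ * _)); exact: mulrC.
  under eq_bigr => k Sk do rewrite first_orthogonality_relation toK_nat.
  case Sj: (S j); last first.
    rewrite big1 ?mul0r // => k Sk; case: eqP => [jk|_]; last by rewrite mulr0.
    by rewrite jk Sk in Sj.
  rewrite (bigD1 j) //= eqxx mulr1 big1 ?addr0 ?divff ?toK_irr1_neq0 // => k /andP[_ kj].
  by rewrite eq_sym (negPf kj) mulr0.
have Sb j : S j -> omega j b = 1 by rewrite omb => /andP[-> _].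
have Zd : in_center X (b - eps) by apply: gcenterB.
suff beps : b = eps.
  exists y => //; apply: center_eq_omega => // j.
  have [Sj|S'j] := boolP (S j); first by rewrite w1 // Sb.
  by have := omeps j; rewrite -beps (negPf S'j) omw => ->; rewrite mulr0.
have [||||eps0|/eqP] := prim_b eps (b - eps).
- split=> //; apply: center_eq_omega => // [|j]; first exact: gcenterM.
  by rewrite omegaM // omeps -natrM mulnb andbb.
- split=> //; apply: center_eq_omega => // [|j]; first exact: gcenterM.
  rewrite omegaM // omegaB omeps omb /S; case: (_ != 0); rewrite /= ?subr0 ?mulr0 //.
  by case: (~~ _); rewrite ?subrr ?mulr0 // subr0 mulr1.
- apply: center_eq_omega => [||j]; first exact: gcenterM.
    split=> [g _|c _]; first by rewrite ffunE.
    by apply/ffunP=> g; rewrite !gmulE !big1 // => x _; rewrite ffunE ?mulr0 ?mul0r.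
  rewrite omegaM // omegaB omeps omega0; case Sj: (S j); last by rewrite mul0r.
  by rewrite Sb // subrr mulr0.
- by rewrite addrC subrK.
- have := omeps i; rewrite eps0 omega0 /S bi /=; have /boolp.asboolPn -> := zi.
  by move/esym/eqP; rewrite oner_eq0.
by rewrite subr_eq0 => /eqP.
Qed.

Definition class_sum g : {ffun gT -> O} := [ffun x => (x \in (g ^: X)%g)%:R].

Lemma class_sum_center g : g \in X -> in_center X (class_sum g).
Proof.
move=> Xg; apply: conj_gcenter => [x X'x | x t Xt]; rewrite !ffunE.
  by case: imsetP => // -[t Xt xE]; rewrite xE groupJ in X'x.
by rewrite class_sym classGidl // class_sym.
Qed.

(** The conjugates of [g] under representatives of [X / Q] run over the class
[|C_X(g):Q|] times, a number invertible in [O] when [Q] is a Sylow subgroup. *)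
Lemma class_sum_trace Q g : g \in X -> (p.-Sylow('C_X[g]) Q)%g ->
  rel_projective X (class_sum g) Q /\
  exists a, [/\ in_galg X a, fixed_by Q a & class_sum g = rel_trace Q X a].
Proof.
move=> Xg sylQ; have sQC := pHall_sub sylQ.
have sQX : Q \subset X := subset_trans sQC (subsetIl _ _).
have [u uE] : @inO p M #|('C_X[g])%g : Q|%g%:R^-1.
  by apply: inO_natV; case/and3P: sylQ.
have cQ t : t \in Q -> (g ^ t)%g = g.
  move=> /(subsetP sQC)/setIP[_ /cent1P gt].
  by apply/conjg_fixP/commgP.
pose a : {ffun gT -> O} := [ffun x => u * (x == g)%:R].
have aQ : fixed_by Q a.
  move=> t x Qt; rewrite !ffunE; congr (_ * _%:R).
  by rewrite -{1}(cQ t Qt) (inj_eq (conjg_inj t)).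
have Xa : in_galg X a.
  by move=> x X'x; rewrite ffunE; case: eqP => [xg|_]; rewrite ?mulr0 // xg Xg in X'x *.
have clE : class_sum g = rel_trace Q X a.
  apply/ffunP=> h; apply: (@mulnO_inj _ M _ Q); rewrite rel_trace_sum // ffunE.
  have [/imsetP[s Xs ->]|hg] := boolP (h \in (g ^: X)%g); last first.
    rewrite mulr0 big1 // => t Xt; rewrite ffunE.
    case: eqP => [htg|_]; last by rewrite mulr0.
    by case/negP: hg; rewrite -htg classGidl // class_refl.
  rewrite mulr1 (reindex_inj (mulgI s^-1)%g) /=.
  rewrite (eq_bigr (fun t => if t \in 'C[g]%g then u else 0)) => [|t _]; last first.
    rewrite ffunE -conjgM mulKVg (sameP eqP conjg_fixP) (sameP commgP cent1P) cent1C.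
    by case: ifP => _; rewrite ?mulr1 ?mulr0.
  rewrite -big_mkcondr (eq_bigl (mem 'C_X[g]%g)) => [|t]; last first.
    by rewrite groupMl ?groupV // -in_setI.
  rewrite sumr_const -[RHS]mulr_natl -(Lagrange sQC) natrM -mulrA.
  rewrite -[LHS]mulr1; congr (_ * _); apply/eqP.
  rewrite -tofrac_eq rmorphM rmorph_nat /= -uE rmorph1.
  by rewrite divff // natK_eq0 -lt0n indexg_gt0.
by split; [split=> //; exists a | exists a].
Qed.

Lemma omega_class_expansion i b : in_center X b ->
  omega i b = \sum_(C in classes X) tofrac (b (repr C)) * omega i (class_sum (repr C)).
Proof.
move=> Zb; have eval_cl g : g \in X ->
    eval 'chi_i (class_sum g) = #|(g ^: X)%g|%:R * toK ('chi_i g).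
  move=> Xg; rewrite mulr_natl -sumr_const /cfun_eval.
  rewrite [RHS]big_mkcond [LHS]big_mkcond; apply: eq_bigr => x _ /=.
  rewrite ffunE; case: imsetP => [[t Xt ->]|_]; last first.
    by case: ifP; rewrite ?rmorph0 ?mul0r.
  by rewrite groupJ // rmorph1 mul1r cfunJ.
rewrite [LHS]/central_char {1}/cfun_eval sum_by_classes => [|g t Xg Xt]; last first.
  by rewrite (gcenter_conj g Zb) // cfunJ.
rewrite mulr_suml; apply: eq_bigr => C /repr_classesP[Xr CE].
by rewrite /central_char mulrA eval_cl // -CE [tofrac _ * (_ * _)]mulrCA.
Qed.

(** The expansion of [omega_i(b) = 1] in class sums has a term outside the
maximal ideal. *)
Lemma defect_class i b : central_idem X b -> omega i b = 1 ->
  exists g, [/\ g \in X, red (b g) <> 0 & ~ in_max (omega i (class_sum g))].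
Proof.
move=> [Zb _]; rewrite omega_class_expansion // => b1.
have [C clC Cmax] : exists2 C, C \in classes X &
    ~ in_max (tofrac (b (repr C)) * omega i (class_sum (repr C))).
  apply: boolp.contrapT => noC; apply: (@not_in_max1 _ M); rewrite -b1.
  apply: in_max_sum => C clC; apply: boolp.contrapT => Cmax.
  by apply: noC; exists C.
have /repr_classesP[Xr _] := clC; exists (repr C); split=> // r0; apply: Cmax.
  apply: in_maxMr; first exact/in_max_tofrac.
  exact/omega_inO/class_sum_center.
by apply: in_maxMl => //; apply: inO_tofrac.
Qed.

(** A Sylow subgroup [Q] of the centralizer of an element [g] as in
[defect_class] can be taken inside [P].  Then [b] is a multiple of the class
sum of [g], hence a trace from [Q], and minimality of [P] gives [Q = P]; the
nonzero coefficient of [b] at [g] puts [Q] into a conjugate of [D]. *)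
Lemma defect_group_conj_sub b P D i :
    is_block X b -> is_defect_group X b P -> rel_projective X b D ->
    eval 'chi_i b != 0 ->
  exists2 x, x \in X & (P \subset D :^ x)%g.
Proof.
move=> blk [prP minP] prD bi; have [Ib _ _] := blk.
have b1 : omega i b = 1.
  by rewrite /central_char (eval_idem rX Ib) // divff ?toK_irr1_neq0.
have [g0 [Xg0 bg0 omg0]] := defect_class Ib b1.
have [Q0 sylQ0] := Sylow_exists p 'C_X[g0]%g.
have pQ0 := pHall_pgroup sylQ0.
have [s Xs sQ0P] := rel_projective_cent prP pQ0 (pHall_sub sylQ0) bg0.
pose g := (g0 ^ s^-1)%g; pose Q := (Q0 :^ s^-1)%G.
have Xs' : (s^-1 \in X)%g by rewrite groupV.
have Xg : g \in X by rewrite groupJ.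
have bg : red (b g) <> 0 by rewrite /g (gcenter_conj g0 (proj1 Ib)).
have clg : class_sum g = class_sum g0.
  by apply/ffunP=> x; rewrite !ffunE classGidl.
have sylQ : (p.-Sylow('C_X[g]) Q)%g.
  by rewrite /g cent1J -{1}(conjGid Xs') -conjIg pHallJ2.
have sQP : Q \subset P by rewrite sub_conjgV.
have [prQ [a [Xa aQ clE]]] := class_sum_trace Xg sylQ.
have sQX := proj1 prQ.
have [y Zy clyE] : exists2 y, in_center X y & gmul (class_sum g) y = b.
  by apply: block_local bi _ => //; [apply: class_sum_center | rewrite clg].
have prbQ : rel_projective X b Q.
  split=> //; exists (gmul a y); split; first exact: in_galg_gmul Xa (proj1 Zy).
    exact: fixed_gmul aQ (gcenter_fixed Zy sQX).
  by rewrite -clyE clE rel_trace_gmul.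
rewrite -(minP Q sQP prbQ).
exact: rel_projective_cent prD (pHall_pgroup sylQ) (pHall_sub sylQ) bg.
Qed.

Lemma card_defect_group b P D i :
    is_block X b -> is_defect_group X b P -> is_defect_group X b D ->
    eval 'chi_i b != 0 -> #|P| = #|D|.
Proof.
move=> blk dP dD bi; apply/eqP; rewrite eqn_leq.
have [x _ /subset_leq_card] := defect_group_conj_sub blk dP (proj1 dD) bi.
have [y _ /subset_leq_card] := defect_group_conj_sub blk dD (proj1 dP) bi.
by rewrite !cardJg => -> ->.
Qed.

Lemma Irr0B_Irr0P b P i : is_block X b -> is_defect_group X b P ->
  i \in Irr0B X b -> i \in Irr0P M X P.
Proof.
move=> blk dP; rewrite /Irr0B in_set => /andP[bi /boolp.asboolP[D dD iD]].
rewrite /Irr0P in_set iD /IrrP in_set; apply/andP; split.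
  by apply/boolp.asboolP; exists b; split=> //; exists P.
have [[sPX _] _] := dP; have [[sDX _] _] := dD.
have cardPD : #|P| = #|D|.
  by apply: (card_defect_group blk dP dD (i := i)); move: bi; rewrite inE.
by rewrite -!divgS // cardPD.
Qed.

Lemma Irr0P_Irr0B b P i : is_block X b -> is_defect_group X b P ->
  i \in Irr0P M X P -> (i \in Irr0B X b) = (eval 'chi_i b != 0).
Proof.
move=> blk dP; rewrite /Irr0P in_set => /andP[_ /eqP iP].
rewrite /Irr0B in_set /IrrB in_set; apply: andb_idr => _.
by apply/boolp.asboolP; exists P.
Qed.

End DefectGroups.

(** * Transfer along the signed bijection *)

Lemma telescope_frac (F : fieldType) (u v w m n : F) : m != 0 -> n != 0 ->
  (u - m * v) / (m * n) + (v - w) / n = (u - m * w) / (m * n).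
Proof. by move=> m0 n0; field; rewrite m0 n0. Qed.

Lemma galgB (gT : finGroupType) (R : zmodType) (a b : {ffun gT -> R}) g :
  (a - b) g = a g - b g.
Proof. by rewrite !ffunE. Qed.

Section SignedIrr.
Variables (p : nat) (gT : finGroupType) (X : {group gT}).
Implicit Types (i j : Iirr X) (s : bool).

Definition signed_irr s j : 'CF(X) := if s then - 'chi_j else 'chi_j.

Lemma pmP (A : {set Iirr X}) phi :
  pm A phi <-> exists2 j, j \in A & exists s, phi = signed_irr s j.
Proof.
split=> [[j Aj [->|->]]|[j Aj [[] ->]]]; exists j => //.
- by exists false.
- by exists true.
- by right.
- by left.
Qed.

(** Degrees are positive, so that no irreducible character is the opposite of
another one. *)
Lemma signed_irr_inj s s' j j' : signed_irr s j = signed_irr s' j' -> j = j'.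
Proof.
have pos k : 0 < 'chi[X]_k 1%g by apply: irr1_gt0.
have neq k k' : - 'chi[X]_k <> 'chi_k'.
  move/cfunP/(_ 1%g); rewrite cfunE => kk'; have := pos k'.
  by rewrite -kk' oppr_gt0 => /(lt_trans (pos k)); rewrite ltxx.
case: s; case: s' => /=.
- by move/oppr_inj/irr_inj.
- by move/neq.
- by move/esym/neq.
- by move/irr_inj.
Qed.

Lemma p'part_deg_signed s j :
  p'part p (deg (signed_irr s j)) = (-1) ^+ s * ((irr_degree_nat j)`_p^')%:Z.
Proof.
have -> : deg (signed_irr s j) = (-1) ^+ s * (irr_degree_nat j)%:Z.
  case: s => /=; last by rewrite degE expr0 mul1r.
  rewrite /deg cfunE irr_degree_natE expr1 mulN1r.
  by rewrite -[(irr_degree_nat j)%:R]/((Posz _)%:~R) -mulrNz intrKfloor.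
have d_gt0 := irr_degree_nat_gt0 j.
rewrite /p'part abszMsign absz_nat sgzM.
rewrite (gtr0_sgz (_ : 0 < (irr_degree_nat j)%:Z)) ?ltz_nat //.
by rewrite mulr1; case: s; rewrite ?expr1 ?expr0 ?sgzN sgz1.
Qed.

End SignedIrr.

Section BlockCharacters.
Variables (p : nat) (M : modular_system p) (gT : finGroupType) (X P : {group gT}).
Hypotheses (rX : has_roots_of_unity M #|X|) (sPX : P \subset X) (pP : (p.-group P)%g).
Local Notation O := (ms_O M).
Local Notation K := {fraction (ms_O M)}.
Local Notation eval := (@cfun_eval p M gT X).
Implicit Types (i j : Iirr X) (z b : {ffun gT -> O}).

Lemma signed_irr_liftable s j x : liftable M (signed_irr s j x).
Proof.
by case: s => /=; rewrite ?cfunE; [apply: liftableN|]; apply: irr_liftable.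
Qed.

Lemma eval_signed_irr s j z : eval (signed_irr s j) z = (-1) ^+ s * eval 'chi_j z.
Proof.
case: s; rewrite /= ?expr0 ?mul1r // expr1 mulN1r eval_cfunN //.
by move=> x; apply: irr_liftable.
Qed.

Lemma liftable_int (m : int) : liftable M m%:~R.
Proof. by exists m%:~R; rewrite rmorph_int. Qed.

Lemma int_comb_liftable (A : {set Iirr X}) (c : Iirr X -> algC) x :
  (forall k, c k \in Num.int) -> liftable M ((\sum_(k in A) c k *: 'chi_k) x).
Proof.
move=> Zc; rewrite sum_cfunE; apply: liftable_sum => k _; rewrite cfunE.
have /intrP[m ->] := Zc k.
by apply: liftableM; [apply: liftable_int | apply: irr_liftable].
Qed.

Lemma eval_int_comb (A : {set Iirr X}) (c : Iirr X -> algC) z :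
  (forall k, c k \in Num.int) ->
  eval (\sum_(k in A) c k *: 'chi_k) z = \sum_(k in A) toK M (c k) * eval 'chi_k z.
Proof.
move=> Zc; rewrite /cfun_eval.
have cE k : liftable M (c k) by have /intrP[m ->] := Zc k; apply: liftable_int.
transitivity (\sum_(x in X) \sum_(k in A)
                tofrac (z x) * (toK M (c k) * toK M ('chi_k x))).
  apply: eq_bigr => x _; rewrite sum_cfunE toK_sum => [|k _]; last first.
    by rewrite cfunE; apply: liftableM => //; apply: irr_liftable.
  rewrite mulr_sumr; apply: eq_bigr => k _; rewrite cfunE toKM //; exact: irr_liftable.
rewrite exchange_big; apply: eq_bigr => k _ /=; rewrite mulr_sumr.
by apply: eq_bigr => x _; rewrite mulrCA.
Qed.

(** The characters removed by the projection do not belong to [b]. *)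
Lemma eval_ProjP (phi : 'CF(X)) b : phi \in 'Z[irr X]%g ->
    is_block X b -> is_defect_group X b P ->
  eval (ProjP M P phi) b = eval phi b.
Proof.
move=> Zphi blk dP.
have Zc k : '[phi, 'chi_k] \in Num.int by rewrite Cint_cfdot_vchar_irr.
rewrite /ProjP eval_int_comb // {2}[phi]cfun_sum_cfdot.
rewrite -[X in eval X b](_ : \sum_(k in setT) '[phi, 'chi_k] *: 'chi_k = _).
  rewrite eval_int_comb // [RHS](big_setID (IrrP M X P)) /= setTI.
  rewrite [X in _ + X]big1 ?addr0 // => k; rewrite inE => /andP[P'k _].
  case: (eqVneq (eval 'chi_k b) 0) => [->|bk]; first by rewrite mulr0.
  case/negP: P'k; rewrite inE; apply/boolp.asboolP; exists b; split=> //.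
    by exists P.
  by rewrite inE.
by apply: eq_bigl => k; rewrite in_setT.
Qed.

(** The block of [chi_i] is a trace from some [D] contained in [P]; were [D]
proper, [chi_i(1)] would be divisible by [p |X:P|_p]. *)
Lemma Irr0P_block i : i \in Irr0P M X P ->
  exists f, [/\ central_idem X f, rel_projective X f P & eval 'chi_i f != 0].
Proof.
move=> Pi; have i_max := Irr0P_degree Pi.
move: Pi; rewrite /Irr0P in_set => /andP[]; rewrite /IrrP in_set.
case/boolp.asboolP=> f [blk [D [prD minD] sDP]]; rewrite /IrrB in_set => fi _.
have [If _ _] := blk; exists f; split=> //.
suff DP : D = P by rewrite -DP.
apply/val_inj/eqP => /=; rewrite eqEsubset sDP /=; apply: boolp.contrapT => /negP nPD.
have DfP : D \proper P by rewrite properE sDP.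
have [sDX [a [_ aD fE]]] := prD; apply: i_max.
rewrite -(toK_irr1 M) -(eval_idem rX If fi) fE eval_rel_trace //.
rewrite -(Lagrange_index sPX sDP) natrM -[_ * _ * eval _ _]mulrA mulrAC.
rewrite divff ?index_neq0 // mul1r; apply: in_maxMr; last exact: eval_inO.
rewrite (in_max_nat M).
have [k kE] := p_natP (pnat_dvd (dvdn_indexg P D) pP).
rewrite kE; case: k kE => [|k] kE; last by rewrite dvdn_exp.
by move: DfP; rewrite properE -(indexg_eq1 P D) kE expn0 eqxx andbF.
Qed.

End BlockCharacters.

Section Correspondence.
Variables (p : nat) (M : modular_system p) (gT : finGroupType) (G P H : {group gT}).
Hypotheses (rG : has_roots_of_unity M #|G|) (sPG : P \subset G) (pP : (p.-group P)%g)
  (sHG : H \subset G) (sNH : 'N_G(P)%g \subset H).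
Variable F : 'CF(G) -> 'CF(H).
Hypotheses (F_signed : signed_bijection M P F)
  (F_witness : witnesses_WIRC M P F \/ witnesses_WIRCstar M P F).
Local Notation O := (ms_O M).
Local Notation K := {fraction (ms_O M)}.
Local Notation red := (ms_red M).
Implicit Types (i : Iirr G) (j : Iirr H) (b e : {ffun gT -> O}).

Let sPH : P \subset H.
Proof. by apply: subset_trans sNH; rewrite subsetI sPG normG. Qed.

Let rH : has_roots_of_unity M #|H|.
Proof. exact: roots_subgroup rG _ sHG. Qed.

Lemma P_notin_SGPH : P \notin SGPH G P H.
Proof.
rewrite inE subxx /=; apply/existsP=> -[t /andP[/setDP[Gt H't]]].
move=> sPt; case/negP: H't; apply: (subsetP sNH); rewrite inE Gt /= -groupV.
by apply/normP/eqP; rewrite eq_sym eqEcard sPt cardJg leqnn.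
Qed.

Lemma Brauer_correspondent_red b e g : Brauer_correspondent G H P b e ->
  g \in ('C_G(P))%g -> red (b g) = red (e g).
Proof.
move=> [_ _ /ffunP/(_ g)]; rewrite !ffunE => Breb Cg; rewrite Cg in Breb.
rewrite -Breb ifT //; case/setIP: Cg => Gg cPg; rewrite inE cPg andbT.
by rewrite (subsetP sNH) // inE Gg (subsetP (cent_sub P)).
Qed.

Lemma indexGHP : #|G : P|%g%:R = #|G : H|%g%:R * #|H : P|%g%:R :> K.
Proof. by rewrite -natrM Lagrange_index. Qed.

Let index_GH0 : #|G : H|%g%:R != 0 :> K.
Proof. by rewrite natK_eq0 -lt0n indexg_gt0. Qed.

(** The common consequence of the two kinds of congruence, from which the rest
follows. *)
Lemma witness_eval_congr b e i j s :
    is_block G b -> is_defect_group G b P -> Brauer_correspondent G H P b e ->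
    i \in Irr0P M G P -> j \in Irr0P M H P -> F 'chi_i = signed_irr s j ->
  in_max ((cfun_eval 'chi_i b
           - #|G : H|%g%:R * cfun_eval (signed_irr s j) e) / #|G : P|%g%:R).
Proof.
move=> blk dP be Pi Pj Fij; have [blk_e dPe _] := be.
have [[Zb _] _ _] := blk; have [[Ze _] _ _] := blk_e.
have redbe g := Brauer_correspondent_red (g := g) be.
case: F_witness => [|] /(_ i Pi); rewrite Fij => -[c [d [Cc Id cdE]]].
- (* The congruence lives on [H] and is evaluated at [e]; the passage from [e]
     to [b] takes place in [G], through the trace [t] from [P] of an element
     whose trace to [H] is [e]. *)
  have negl : negligible P e (c + d).
    apply: negligibleD; first exact: CpP_negligible.
    exact: IXPS_negligible P_notin_SGPH Id.
  have Zres : 'Res[H] 'chi_i \in 'Z[irr H]%g.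
    by apply: char_vchar; apply/cfRes_char/irr_char.
  have [_ ] := negl; rewrite -cdE.
  rewrite eval_cfunD; last 2 first.
  - by move=> x; apply: signed_irr_liftable.
  - move=> x; rewrite cfunE; apply/liftableN/int_comb_liftable => // k.
    by rewrite Cint_cfdot_vchar_irr.
  rewrite eval_cfunN => [|x]; last first.
    by apply: int_comb_liftable => // k; rewrite Cint_cfdot_vchar_irr.
  rewrite eval_ProjP //.
  have [[_ [a [Ha aP eE]]] _] := dPe.
  have Ga : in_galg G a.
    by move=> x G'x; apply: Ha; apply: contra G'x; apply: (subsetP sHG).
  pose t := rel_trace P G a.
  have Zt : in_center G t by apply: rel_trace_center.
  have tE : cfun_eval 'chi_i t = #|G : H|%g%:R * cfun_eval ('Res[H] 'chi_i) e.
    by rewrite eE !eval_rel_trace // eval_res // indexGHP mulrA.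
  have smG : in_max (cfun_eval 'chi_i (b - t) / #|G : P|%g%:R).
    have [f [If prf fi]] := Irr0P_block rG sPG pP Pi.
    apply: (in_max_eval_center rG sPG pP If prf fi); first exact: gcenterB.
    move=> x Cx; rewrite galgB rmorphB (redbe _ Cx).
    by rewrite (red_rel_trace_norm sPH sHG sNH aP pP Cx) eE subrr.
  move/in_maxN; rewrite -mulNr opprB => smH; have := in_maxD smG smH.
  by rewrite evalB tE indexGHP telescope_frac // index_neq0.
- (* The congruence lives on [G] and is evaluated at [b]; the passage from [b]
     to [e] takes place in [H], through the restriction [bH] of [b]. *)
  have [_ ] : negligible P b (c + d).
    apply: negligibleD; first exact: CpP_negligible.
    exact: IXPS_negligible P_notin_SGPH Id.
  rewrite -cdE => smG.
  have sjE x : liftable M (signed_irr s j x) by apply: signed_irr_liftable.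
  rewrite eval_cfunD in smG; last 2 first.
  - by move=> x; apply: irr_liftable.
  - by move=> x; rewrite cfunE; apply/liftableN/ind_liftable.
  rewrite eval_cfunN ?eval_ind // in smG; last exact: ind_liftable.
  pose bH : {ffun gT -> O} := [ffun g => if g \in H then b g else 0].
  have ZbH : in_center H bH by apply: gcenter_restrict Zb sHG.
  have smH : in_max (cfun_eval 'chi_j (bH - e) / #|H : P|%g%:R).
    have [f [If prf fj]] := Irr0P_block rH sPH pP Pj.
    apply: (in_max_eval_center rH sPH pP If prf fj); first exact: gcenterB.
    move=> x /setIP[Hx cPx]; rewrite galgB ffunE Hx rmorphB redbe ?subrr //.
    by rewrite inE (subsetP sHG).
  have bHE : cfun_eval (signed_irr s j) bH = cfun_eval (signed_irr s j) b.
    by apply: eq_bigr => x Hx; rewrite ffunE Hx.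
  have := in_maxD smG (in_maxMl (inO_int M ((-1) ^+ s)) smH).
  rewrite evalB mulrA mulrBr rmorphXn rmorphN1 -!eval_signed_irr // bHE.
  by rewrite indexGHP telescope_frac // index_neq0.
Qed.

(** Neither degree, divided by [|G:P|] or [|H:P|], is in the maximal ideal, so
the two sides of [witness_eval_congr] vanish together; when they do not, the
congruence is one between rational integers after multiplication by the
p'-part of [|G:P|]. *)
Lemma witness_transfer b e i j s :
    is_block G b -> is_defect_group G b P -> Brauer_correspondent G H P b e ->
    i \in Irr0P M G P -> j \in Irr0P M H P -> F 'chi_i = signed_irr s j ->
  (cfun_eval 'chi_i b != 0) = (cfun_eval 'chi_j e != 0) /\
  (cfun_eval 'chi_i b != 0 ->
    (p'part p (deg 'chi_i)
       = (#|G : H|%g`_p^')%:Z * p'part p (deg (signed_irr s j)) %[mod p])%Z).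
Proof.
move=> blk dP be Pi Pj Fij; have := witness_eval_congr blk dP be Pi Pj Fij.
have [Ib _ _] := blk; have [[Ie _ _] _ _] := be.
have i_max := Irr0P_degree Pi; have j_max := Irr0P_degree Pj.
set di := irr_degree_nat i; set dj := irr_degree_nat j.
have index_HP0 : #|H : P|%g%:R != 0 :> K := index_neq0 M H P.
have jE : #|G : H|%g%:R * dj%:R / #|G : P|%g%:R = dj%:R / #|H : P|%g%:R :> K.
  by rewrite indexGHP -mulf_div divff ?mul1r.
rewrite eval_signed_irr // mulrBl.
have sgn_max (x : K) : in_max ((-1) ^+ s * x) -> in_max x.
  by case: (s); rewrite ?expr0 ?mul1r // expr1 mulN1r => /in_maxN; rewrite opprK.
have [ib|ib] := eqVneq (cfun_eval 'chi_i b) 0;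
  have [je|je] := eqVneq (cfun_eval 'chi_j e) 0; try by [].
- rewrite ib mul0r sub0r => /in_maxN; rewrite opprK (eval_idem rH Ie) //.
  rewrite toK_irr1 mulrCA -mulrA jE; by move/sgn_max/j_max.
- by rewrite je !mulr0 mul0r subr0 (eval_idem rG Ib) // toK_irr1 => /i_max.
rewrite (eval_idem rG Ib) // (eval_idem rH Ie) // !toK_irr1 => sm; split=> // _.
have -> : p'part p (deg 'chi_i) = (di`_p^')%:Z.
  by rewrite -[RHS]mul1r -(expr0 (-1)) -(p'part_deg_signed p false).
rewrite p'part_deg_signed -/dj; apply/eqP; rewrite eqz_mod_dvd; apply/(in_max_int M).
have di_gt0 : (0 < di)%N := irr_degree_nat_gt0 i.
have dj_gt0 : (0 < dj)%N := irr_degree_nat_gt0 j.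
have iP : logn p di = logn p #|G : P|%g.
  by move: Pi; rewrite /Irr0P in_set vp_deg => /andP[_ /eqP].
have jP : logn p dj = logn p #|H : P|%g.
  by move: Pj; rewrite /Irr0P in_set vp_deg => /andP[_ /eqP].
have ratio_p' m : (0 < m)%N -> logn p m = logn p #|G : P|%g ->
    m%:R / #|G : P|%g%:R * (#|G : P|%g`_p^')%:R = (m`_p^')%:R :> K.
  move=> m_gt0 mP; rewrite -{1}(partnC p m_gt0) -{1}(partnC p (indexg_gt0 G P)).
  rewrite !p_part mP !natrM -mulf_div divff ?mul1r ?divfK // natK_eq0 -lt0n.
    by rewrite part_gt0.
  by rewrite expn_gt0 prime_gt0 ?(ms_prime M).
have := in_maxMr sm (inO_nat M (#|G : P|%g`_p^')).
rewrite mulrBl ratio_p' // (_ : #|G : H|%g%:R * _ / _ * _ = (-1) ^+ s *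
    ((#|G : H|%g * dj)%N%:R / #|G : P|%g%:R * (#|G : P|%g`_p^')%:R)); last first.
  by rewrite natrM [_ * ((-1) ^+ s * _)]mulrCA !mulrA.
rewrite ratio_p' ?muln_gt0 ?indexg_gt0 //; last first.
  by rewrite lognM ?indexg_gt0 // jP -lognM ?indexg_gt0 // Lagrange_index.
rewrite partnM ?indexg_gt0 // natrM.
by rewrite rmorphB !rmorphM rmorphXn rmorphN1 /= mulrCA.
Qed.

Lemma F_irr i : i \in Irr0P M G P ->
  exists2 j, j \in Irr0P M H P & exists s, F 'chi_i = signed_irr s j.
Proof.
move=> Pi; have [[Fpm _ _] _] := F_signed.
by apply/pmP/Fpm/pmP; exists i => //; exists false.
Qed.

Lemma F_signed_irr i s : i \in Irr0P M G P ->
  F (signed_irr s i) = if s then - F 'chi_i else F 'chi_i.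
Proof.
move=> Pi; have [_ FN] := F_signed; case: s => //=; rewrite FN //.
by apply/pmP; exists i => //; exists false.
Qed.

Lemma F_irr_inj i1 i2 j s1 s2 : i1 \in Irr0P M G P -> i2 \in Irr0P M G P ->
  F 'chi_i1 = signed_irr s1 j -> F 'chi_i2 = signed_irr s2 j -> i1 = i2.
Proof.
move=> P1 P2 F1 F2; have [[_ Finj _] _] := F_signed.
have pm_mem i s : i \in Irr0P M G P -> pm (Irr0P M G P) (signed_irr s i).
  by move=> Pi; apply/pmP; exists i => //; exists s.
have F12 : F (signed_irr false i1) = F (signed_irr (s1 (+) s2) i2).
  by rewrite !F_signed_irr // F1 F2; case: (s1); case: (s2); rewrite /= ?opprK.
apply: (@signed_irr_inj _ _ false (s1 (+) s2)).
by apply: Finj F12; apply: classical_sets.mem_set; apply: pm_mem.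
Qed.

Lemma F_irr_surj j : j \in Irr0P M H P ->
  exists2 i, i \in Irr0P M G P & exists s, F 'chi_i = signed_irr s j.
Proof.
move=> Pj; have [[_ _ Fsurj] _] := F_signed.
have [|phi /pmP[i Pi [s ->]] Fphi] := Fsurj 'chi_j.
  by apply/pmP; exists j => //; exists false.
exists i => //; exists s; move: Fphi; rewrite F_signed_irr //.
by case: s => //= <-; rewrite opprK.
Qed.

Lemma Mcount_transfer b e (l : int) :
    is_block G b -> is_defect_group G b P -> Brauer_correspondent G H P b e ->
  Mcount G b ((#|G : H|%g`_p^')%:Z * l) = Mcount H e l.
Proof.
move=> blk dP be; have [blk_e dPe _] := be; rewrite /Mcount.
set m := ((#|G : H|%g`_p^')%:Z); set A := [set i in _ | _]; set B := [set i in _ | _].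
have /fin_all_exists[f fE] i : exists j, i \in Irr0P M G P ->
    j \in Irr0P M H P /\ exists s, F 'chi_i = signed_irr s j.
  have [/F_irr[j Pj Fj]|_] := boolP (i \in Irr0P M G P); first by exists j.
  by exists 0.
have AP i : i \in A -> i \in Irr0P M G P.
  by case/setIdP=> /(Irr0B_Irr0P rG blk dP).
suff -> : B = f @: A.
  rewrite card_in_imset // => i1 i2 /AP P1 /AP P2 f12.
  have [_ [s1 F1]] := fE _ P1; have [_ [s2 F2]] := fE _ P2.
  by rewrite -f12 in F2; apply: F_irr_inj F1 F2.
have ABf i : i \in Irr0P M G P -> (i \in A) = (f i \in B).
  move=> Pi; have [Pj [s Fi]] := fE i Pi.
  have [ije degs] := witness_transfer blk dP be Pi Pj Fi.
  have -> : (i \in A) = (cfun_eval 'chi_i b != 0)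
      && ((p'part p (deg 'chi_i) == m * l %[mod p])%Z
      || (p'part p (deg 'chi_i) == - (m * l) %[mod p])%Z).
    by rewrite /A in_set (Irr0P_Irr0B blk dP Pi).
  have -> : (f i \in B) = (cfun_eval 'chi_(f i) e != 0)
      && ((p'part p (deg 'chi_(f i)) == l %[mod p])%Z
      || (p'part p (deg 'chi_(f i)) == - l %[mod p])%Z).
    by rewrite /B in_set (Irr0P_Irr0B blk_e dPe Pj).
  rewrite -ije; case: (_ != 0) degs => //= /(_ isT) ->.
  rewrite p'part_deg_signed -[deg 'chi_(f i)]/(deg (signed_irr false (f i))).
  rewrite p'part_deg_signed expr0 mul1r !eqz_mod_dvd.
  have m_dvd (x : int) : (p %| m * x)%Z = (p %| x)%Z.
    apply: Gauss_dvdzr; rewrite /m coprimezE /= prime_coprime ?(ms_prime M) //.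
    by rewrite -p'natE ?(ms_prime M) // part_pnat.
  rewrite -/m; set d := (_`_p^')%:Z; case: s {Fi}; rewrite ?expr0 ?expr1 ?mul1r.
    have -> : m * (-1 * d) - m * l = - (m * (d - - l)) by ring.
    have -> : m * (-1 * d) - - (m * l) = - (m * (d - l)) by ring.
    by rewrite !rpredN !m_dvd orbC.
  by rewrite -mulrBr m_dvd -mulrN -mulrBr m_dvd.
apply/setP=> j; apply/idP/imsetP=> [Bj | [i Ai ->]]; last by rewrite -ABf // AP.
have Pj : j \in Irr0P M H P by case/setIdP: Bj => /(Irr0B_Irr0P rH blk_e dPe).
have [i Pi [s Fi]] := F_irr_surj Pj; have [_ [s' Fi']] := fE i Pi.
have jE : j = f i by apply: (@signed_irr_inj _ _ s s'); rewrite -Fi.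
by exists i => //; rewrite ABf // -jE.
Qed.

End Correspondence.

Theorem proposition2p15 (p : nat) (M : modular_system p)
    (gT : finGroupType) (G P H : {group gT})
    (p_prime : prime p)
    (M_large : has_roots_of_unity M #|G|)
    (sPG : P \subset G) (pP : (p.-group P)%g)
    (sHG : H \subset G) (sNH : 'N_G(P)%g \subset H)
    (b e : {ffun gT -> ms_O M})
    (b_block : is_block G b) (b_defect : is_defect_group G b P)
    (e_Brauer : Brauer_correspondent G H P b e)
    (F : 'CF(G) -> 'CF(H))
    (F_signed : signed_bijection M P F)
    (F_witness : witnesses_WIRC M P F \/ witnesses_WIRCstar M P F) :
  (forall i : Iirr G, i \in Irr0B G b ->
     pm (Irr0B H e) (F 'chi_i) /\
     (p'part p (deg 'chi_i)
        = (#|G : H|%g`_p^')%:Z * p'part p (deg (F 'chi_i)) %[mod p])%Z)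
  /\
  (H :=: 'N_G(P)%g ->
   forall b' e' : {ffun gT -> ms_O M},
     is_block G b' -> is_defect_group G b' P ->
     Brauer_correspondent G H P b' e' ->
     forall l : int, ~~ (p %| l)%Z ->
       Mcount G b' ((#|G : H|%g`_p^')%:Z * l) = Mcount H e' l).
Proof.
split=> [i bi | _ b' e' b'_block b'_defect e'_Brauer l _]; last first.
  exact: (Mcount_transfer M_large sPG pP sHG sNH F_signed F_witness).
have [e_block e_defect _] := e_Brauer.
have Pi := Irr0B_Irr0P M_large b_block b_defect bi.
have [j Pj [s Fi]] := F_irr F_signed Pi.
have [ije degs] := witness_transfer M_large sPG pP sHG sNH F_witness
  b_block b_defect e_Brauer Pi Pj Fi.
have ib : cfun_eval 'chi_i b != 0 by rewrite -(Irr0P_Irr0B b_block b_defect Pi).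
split; last by rewrite Fi; apply: degs.
by apply/pmP; exists j; [rewrite (Irr0P_Irr0B e_block e_defect Pj) -ije | exists s].
Qed.
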